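(* Let $\psi:\mathfrak h_A\to\mathbb C$ be a linear map such that $V(\psi)$ has finite dimensional weight spaces with respect to $\mathfrak h$ and such that $A_\psi=\mathbb C[t_1^{\pm r_1},\dots,t_n^{\pm r_n}]$ with $R=r_1\cdots r_n\ge2$. Let $v$ be a highest weight vector of $V(\psi)$. Then for all $k\in\overline\Gamma$ $$U(\widetilde{\mathfrak g}_A)(v\otimes t^k)=(V(\psi)\otimes A)_k ,$$ where $t^k$ denotes $t_1^{k_1}\cdots t_n^{k_n}$ for any representative $(k_1,\dots,k_n)\in\mathbb Z^n$ of $k$.
   Context: $\mathfrak g$ is a Kac-Moody Lie algebra over $\mathbb C$ with Cartan subalgebra $\mathfrak h$ and triangular decomposition $\mathfrak g=N^-\oplus\mathfrak h\oplus N^+$; $\mathfrak g'=[\mathfrak g,\mathfrak g]$, $\mathfrak h'=\mathfrak h\cap\mathfrak g'$, $\mathfrak h=\mathfrak h'\oplus\mathfrak h''$ for a fixed complement $\mathfrak h''$. $A=\mathbb C[t_1^{\pm1},\dots,t_n^{\pm1}]$, $t^m=t_1^{m_1}\cdots t_n^{m_n}$. $\mathfrak g_A=(\mathfrak g'\otimes A)\oplus\mathfrak h''$ with $[X\otimes t^m,Y\otimes t^s]=[X,Y]\otimes t^{m+s}$, $[h,X\otimes t^m]=[h,X]\otimes t^m$, $[h,h_1]=0$ for $X,Y\in\mathfrak g'$, $h,h_1\in\mathfrak h''$; $\mathfrak h_A=(\mathfrak h'\otimes A)\oplus\mathfrak h''$. $D=\bigoplus_{i=1}^n\mathbb Cd_i$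 with $[d_i,X\otimes t^m]=m_iX\otimes t^m$, $[d_i,d_j]=[d_i,\mathfrak h'']=0$, and $\widetilde{\mathfrak g}_A=\mathfrak g_A\oplus D$. For a linear map $\psi:\mathfrak h_A\to\mathbb C$, $V(\psi)$ is the unique irreducible quotient of $M(\psi)=U(\mathfrak g_A)\otimes_{U((N^+\otimes A)\oplus\mathfrak h_A)}\mathbb C$, where $N^+\otimes A$ acts on $\mathbb C$ by $0$ and $\mathfrak h_A$ via $\psi$; a highest weight vector is a nonzero multiple of the image of $1\otimes1$. $A_\psi\subseteq A$ is the image of the algebra homomorphism $U(\mathfrak h'\otimes A)\to A$ extending $h\otimes t^m\mapsto\psi(h\otimes t^m)t^m$. $V(\psi)\otimes A$ is a $\widetilde{\mathfrak g}_A$-module by $(X\otimes t^m)(w\otimes t^s)=((X\otimes t^m)w)\otimes t^{m+s}$, $h(w\otimes t^s)=(hw)\otimes t^s$, $d_i(w\otimes t^s)=s_i(w\otimes t^s)$ for $X\in\mathfrak g'$, $h\in\mathfrak h''$. Fix primitive $r_i$-th roots of unity $\xi_i$ and let $\overline\Gamma=\mathbb Z/r_1\mathbb Z\oplus\cdots\oplus\mathbb Z/r_n\mathbb Z$. For $1\le i\le n$, $\sigma_i$ is the linear automorphism of $V(\psi)$ determined by $\sigma_i(v)=v$, $\sigma_i((X\otimes t^m)w)=\xi_i^{m_i}(X\otimes t^m)\sigma_i(w)$ and $\sigma_i(hw)=h\sigma_i(w)$ for $X\in\mathfrak g'$, $m\in\mathbb Z^n$, $h\in\mathfrak h''$, $w\in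 V(\psi)$. Define the automorphism $\widetilde\eta_i$ of $V(\psi)\otimes A$ by $\widetilde\eta_i(w\otimes t^s)=\xi_i^{-s_i}\sigma_i(w)\otimes t^s$. For $k\in\overline\Gamma$, $$(V(\psi)\otimes A)_k=\{u\in V(\psi)\otimes A\mid\widetilde\eta_i u=\xi_i^{-k_i}u,\ 1\le i\le n\}.$$ *)

(* Defs.v *)
From HB Require Import structures.
From mathcomp Require Import all_boot all_algebra.
From mathcomp Require Import boolp classical_sets reals.
From mathcomp Require Import complex.
From mathcomp Require Import finmap monalg.

Set Implicit Arguments.
Unset Strict Implicit.
Unset Printing Implicit Defensive.

Import GRing.Theory.
Local Open Scope ring_scope.
Local Open Scope classical_set_scope.

Section LinearFacts.
Context {K : fieldType} {V W : lmodType K} (f : V -> W) (f_lin : linear f).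

Lemma lin0 : f 0 = 0.
Proof. by have := f_lin (-1) 0 0; rewrite scaler0 addr0 scaleN1r addNr. Qed.
Lemma linD : {morph f : x y / x + y}.
Proof. by move=> x y; have := f_lin 1 x y; rewrite !scale1r. Qed.
Lemma linZ a : {morph f : x / a *: x}.
Proof. by move=> x; have := f_lin a x 0; rewrite lin0 !addr0. Qed.
Lemma linN : {morph f : x / - x}.
Proof. by move=> x; rewrite -scaleN1r linZ scaleN1r. Qed.
Lemma linB : {morph f : x y / x - y}.
Proof. by move=> x y; rewrite linD linN. Qed.
End LinearFacts.


Definition lspan (K : fieldType) (V : lmodType K) (P : set V) : {pred V} :=
  fun x => `[< forall S : submodClosed V, (forall y, P y -> y \in S) -> x \in S >].

Lemma lspan_closed (K : fieldType) (V : lmodType K) (P : set V) :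
  submod_closed (lspan P).
Proof.
split; first by apply/asboolP => S _; exact: rpred0.
move=> a x y /asboolP Sx /asboolP Sy; apply/asboolP => S PS.
by rewrite rpredD ?rpredZ ?Sx ?Sy.
Qed.

HB.instance Definition _ (K : fieldType) (V : lmodType K) (P : set V) :=
  GRing.isSubmodClosed.Build K V (lspan P) (lspan_closed P).

Lemma lspan_mem (K : fieldType) (V : lmodType K) (P : set V) x :
  P x -> x \in lspan P.
Proof. by move=> Px; apply/asboolP => S; apply. Qed.

Lemma lspan_min (K : fieldType) (V : lmodType K) (P : set V)
    (S : submodClosed V) :
  (forall y, P y -> y \in S) -> {subset lspan P <= S}.
Proof. by move=> PS x /asboolP; apply. Qed.

Definition subm (K : fieldType) (V : lmodType K) (S : submodClosed V) :=
  {x : V | x \in S}.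

HB.instance Definition _ (K : fieldType) (V : lmodType K) (S : submodClosed V) :=
  SubType.copy (subm S) {x : V | x \in S}.
HB.instance Definition _ (K : fieldType) (V : lmodType K) (S : submodClosed V) :=
  [Choice of subm S by <:].
HB.instance Definition _ (K : fieldType) (V : lmodType K) (S : submodClosed V) :=
  [SubChoice_isSubLmodule of subm S by <:].

(* [submodClosed] does not inherit [zmodClosed]; this copy of [S] has both. *)
Definition zsub (K : fieldType) (V : lmodType K) (S : submodClosed V) :
  {pred V} := fun x => x \in S.
HB.instance Definition _ (K : fieldType) (V : lmodType K) (S : submodClosed V) :=
  GRing.isSubmodClosed.Build K V (zsub S) (submodClosedP S).

Definition lquot (K : fieldType) (V : lmodType K) (S : submodClosed V) :=
  Quotient.quot (zsub S).

Section Lquot.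
Context {K : fieldType} {V : lmodType K} (S : submodClosed V).
Local Open Scope quotient_scope.

HB.instance Definition _ := GRing.Zmodule.on (lquot S).

Definition lpi (x : V) : lquot S := \pi_(Quotient.quot (zsub S)) x.
Definition lrepr (q : lquot S) : V := repr (q : Quotient.quot (zsub S)).

Lemma lreprK q : lpi (lrepr q) = q. Proof. exact: reprK. Qed.

Lemma lpiP x y : reflect (lpi x = lpi y) (x - y \in S).
Proof.
rewrite [_ \in S](_ : _ = (x - y \in zsub S)) //.
by rewrite Quotient.idealrBE; exact: eqP.
Qed.

Lemma lpiD : {morph lpi : x y / x + y}.
Proof. by move=> x y; exact: (raddfD \pi_(Quotient.quot (zsub S))). Qed.

Definition lquot_scale (a : K) (q : lquot S) : lquot S := lpi (a *: lrepr q).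

Lemma lpiZ a x : lquot_scale a (lpi x) = lpi (a *: x).
Proof. by apply/lpiP; rewrite -scalerBr rpredZ //; apply/lpiP; rewrite lreprK. Qed.

Lemma lquot_scaleA a b q :
  lquot_scale a (lquot_scale b q) = lquot_scale (a * b) q.
Proof. by rewrite -[q]lreprK !lpiZ scalerA. Qed.
Lemma lquot_scale1 : left_id 1 lquot_scale.
Proof. by move=> q; rewrite -[q]lreprK !lpiZ scale1r. Qed.
Lemma lquot_scaleDr : right_distributive lquot_scale +%R.
Proof.
by move=> a p q; rewrite -[p]lreprK -[q]lreprK -lpiD !lpiZ scalerDr lpiD.
Qed.
Lemma lquot_scaleDl q : {morph lquot_scale^~ q : a b / a + b}.
Proof. by move=> a b; rewrite -[q]lreprK !lpiZ scalerDl lpiD. Qed.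

HB.instance Definition _ := GRing.Zmodule_isLmodule.Build K (lquot S)
  lquot_scaleA lquot_scale1 lquot_scaleDr lquot_scaleDl.

Lemma lpi_is_linear : linear lpi.
Proof. by move=> a x y; rewrite lpiD -lpiZ. Qed.
HB.instance Definition _ := GRing.isLinear.Build K V (lquot S) _ lpi lpi_is_linear.

Lemma lpi_eq0 x : (lpi x == 0) = (x \in S).
Proof.
apply/eqP/idP; last by move=> Sx; rewrite -(linear0 lpi); apply/lpiP; rewrite subr0.
by rewrite -(linear0 lpi) => /lpiP; rewrite subr0.
Qed.
End Lquot.
Arguments lpi {K V} S x.
Arguments lrepr {K V} S q.

Definition finite_dim (K : fieldType) (V : lmodType K) (P : set V) : Prop :=
  exists s : seq V, forall w, P w -> w \in lspan [set y | y \in s].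


HB.mixin Record Lmodule_isLie (K : fieldType) L of GRing.Lmodule K L := {
  lie : L -> L -> L;
  lie_linl : forall y : L, linear (lie^~ y);
  lie_linr : forall x : L, linear (lie x);
  liexx : forall x : L, lie x x = 0;
  jacobi : forall x y z : L,
    lie x (lie y z) + lie y (lie z x) + lie z (lie x y) = 0
}.

#[short(type="lieAlgType")]
HB.structure Definition LieAlgebra (K : fieldType) :=
  {L of Lmodule_isLie K L & GRing.Lmodule K L}.

Lemma lieC (K : fieldType) (L : lieAlgType K) (x y : L) : lie x y = - lie y x.
Proof.
have := liexx (x + y).
rewrite (linD (lie_linl _)) !(linD (lie_linr _)) !liexx add0r addr0 => /eqP.
by rewrite addr_eq0 => /eqP.
Qed.

Lemma lie_leibniz (K : fieldType) (L : lieAlgType K) (x y z : L) :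
  lie x (lie y z) = lie (lie x y) z + lie y (lie x z).
Proof.
have := jacobi x y z; rewrite (lieC z x) (lieC z).
rewrite (linN (lie_linr y)).
by move/eqP; rewrite -addrA -opprD subr_eq0 addrC => /eqP.
Qed.

Definition lie_closed (K : fieldType) (L : lieAlgType K) (S : {pred L}) : Prop :=
  forall x y, x \in S -> y \in S -> lie x y \in S.

Definition lie_ideal (K : fieldType) (L : lieAlgType K) (S : {pred L}) : Prop :=
  forall x y, y \in S -> lie x y \in S.

Definition lie_gen (K : fieldType) (L : lieAlgType K) (P : set L) : set L :=
  [set x | forall S : submodClosed L,
     lie_closed S -> (forall y, P y -> y \in S) -> x \in S].

Record lieModule (K : fieldType) (L : lieAlgType K) (V : lmodType K) :=
  LieModule {
    lact :> L -> V -> V;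
    lact_linl : forall v, linear (lact^~ v);
    lact_linr : forall x, linear (lact x);
    lact_lie : forall x y v,
      lact (lie x y) v = lact x (lact y v) - lact y (lact x v)
  }.

Definition derived (K : fieldType) (L : lieAlgType K) : {pred L} :=
  lspan [set z : L | exists x y, z = lie x y].
HB.instance Definition _ (K : fieldType) (L : lieAlgType K) :=
  GRing.SubmodClosed.on (@derived K L).
Definition derivedAlg (K : fieldType) (L : lieAlgType K) :=
  subm (@derived K L).
HB.instance Definition _ (K : fieldType) (L : lieAlgType K) :=
  GRing.SubLmodule.on (derivedAlg L).

Section Derived.
Context {K : fieldType} {L : lieAlgType K}.
Implicit Types x y z : derivedAlg L.

Lemma mem_derived (x y : L) : lie x y \in @derived K L.
Proof. by apply: lspan_mem; exists x, y. Qed.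

Lemma derived_val_lin : linear (val : derivedAlg L -> L).
Proof. by []. Qed.

Definition derived_ad (x : L) (y : derivedAlg L) : derivedAlg L :=
  Sub (lie x (val y)) (mem_derived x (val y)).

Definition derived_lie x := derived_ad (val x).

Lemma derived_linl y : linear (derived_lie^~ y).
Proof. by move=> a u v; apply: val_inj; exact: lie_linl. Qed.
Lemma derived_linr x : linear (derived_lie x).
Proof. by move=> a u v; apply: val_inj; exact: lie_linr. Qed.
Lemma derived_liexx x : derived_lie x x = 0.
Proof. by apply: val_inj; exact: liexx. Qed.
Lemma derived_jacobi x y z : derived_lie x (derived_lie y z) +
  derived_lie y (derived_lie z x) + derived_lie z (derived_lie x y) = 0.
Proof. by apply: val_inj; exact: jacobi. Qed.
HB.instance Definition _ := Lmodule_isLie.Build K (derivedAlg L)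
  derived_linl derived_linr derived_liexx derived_jacobi.
End Derived.

Definition abelianLie (K : fieldType) (V : lmodType K) : Type := V.
Section Abelian.
Context {K : fieldType} {V : lmodType K}.
HB.instance Definition _ := GRing.Lmodule.on (abelianLie V).
Definition abelian_lie (x y : abelianLie V) : abelianLie V := 0.
Lemma abelian_linl y : linear (abelian_lie^~ y).
Proof. by move=> a u v; apply/esym/eqP; rewrite addr0 scaler_eq0 eqxx orbT. Qed.
Lemma abelian_linr y : linear (abelian_lie y).
Proof. by move=> a u v; apply/esym/eqP; rewrite addr0 scaler_eq0 eqxx orbT. Qed.
Lemma abelian_jacobi (x y z : abelianLie V) : abelian_lie x (abelian_lie y z) +
  abelian_lie y (abelian_lie z x) + abelian_lie z (abelian_lie x y) = 0.
Proof. by rewrite !addr0. Qed.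
HB.instance Definition _ := Lmodule_isLie.Build K (abelianLie V)
  abelian_linl abelian_linr (fun=> erefl) abelian_jacobi.
End Abelian.


(* Finite formal sums of elements of [I] with coefficients in [V]; [fmon x i] is
   [x <i>]. *)
Definition fsum (I : choiceType) (V : zmodType) := {malg V[I]}.

Definition fmon (I : choiceType) (V : zmodType) (x : V) (i : I) : fsum I V :=
  << x *g i >>.

Section FsumModule.
Context {K : fieldType} {I : choiceType} {V : lmodType K}.
Implicit Types u v : fsum I V.

HB.instance Definition _ := GRing.Zmodule.on (fsum I V).

Definition fsum_scale (a : K) u : fsum I V :=
  [malg m in msupp u => a *: u@_m].

Lemma fsum_scaleE a u m : (fsum_scale a u)@_m = a *: u@_m.
Proof. by rewrite mcoeffE; case: msuppP => // _; rewrite scaler0. Qed.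

Lemma fsum_scaleA a b u :
  fsum_scale a (fsum_scale b u) = fsum_scale (a * b) u.
Proof. by apply/malgP => m; rewrite !fsum_scaleE scalerA. Qed.
Lemma fsum_scale1 : left_id 1 fsum_scale.
Proof. by move=> u; apply/malgP => m; rewrite !fsum_scaleE scale1r. Qed.
Lemma fsum_scaleDr : right_distributive fsum_scale +%R.
Proof.
by move=> a u v; apply/malgP => m; rewrite !(mcoeffD, fsum_scaleE) scalerDr.
Qed.
Lemma fsum_scaleDl u : {morph fsum_scale^~ u : a b / a + b}.
Proof.
by move=> a b; apply/malgP => m; rewrite !(mcoeffD, fsum_scaleE) scalerDl.
Qed.

HB.instance Definition _ := GRing.Zmodule_isLmodule.Build K (fsum I V)
  fsum_scaleA fsum_scale1 fsum_scaleDr fsum_scaleDl.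

Lemma lcoefD u v m : (u + v)@_m = u@_m + v@_m. Proof. exact: mcoeffD. Qed.
Lemma lcoefZ a u m : (a *: u)@_m = a *: u@_m.
Proof. exact: fsum_scaleE. Qed.
Lemma lcoefU (x : V) (m k : I) : (fmon x m)@_k = x *+ (m == k).
Proof. exact: mcoeffU. Qed.

Lemma fmon_lin m : linear (fun x : V => fmon x m).
Proof.
move=> a x y; apply/malgP => k; rewrite lcoefD lcoefZ !lcoefU.
by case: eqP => //=; rewrite !mulr0n scaler0 addr0.
Qed.

End FsumModule.


Lemma fsum_ind (I : choiceType) (V : zmodType) (P : fsum I V -> Prop) :
  P 0 -> (forall u v, P u -> P v -> P (u + v)) ->
  (forall x m, P (fmon x m)) -> forall u, P u.
Proof.
by move=> P0 PD PU u; rewrite (monalgE u); elim/big_ind: _ => // m _; exact: PU.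
Qed.

Section Lext.
Context {K : fieldType} {I : choiceType} {V W : lmodType K}.

(* Linear extension of a family of linear maps: [x <m> |-> F m x]. *)
Definition lext (F : I -> V -> W) (u : fsum I V) : W :=
  \sum_(m <- msupp u) F m u@_m.

Context (F : I -> V -> W) (F_lin : forall m, linear (F m)).

Lemma lextEw (d : {fset I}) (u : fsum I V) :
  (msupp u `<=` d)%fset -> lext F u = \sum_(m <- d) F m u@_m.
Proof.
move=> ud; rewrite /lext (big_fset_incl _ ud) //= => m _ /mcoeff_outdom ->.
exact: lin0.
Qed.

Lemma lext_lin : linear (lext F).
Proof.
move=> a u v; pose d := (msupp u `|` msupp v)%fset.
rewrite (@lextEw d) ?(@lextEw d u) ?(@lextEw d v) ?fsubsetUl ?fsubsetUr //.
  rewrite scaler_sumr -big_split /=; apply: eq_bigr => m _.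
  by rewrite lcoefD lcoefZ (linD (F_lin m)) (linZ (F_lin m)).
apply/fsubsetP => m; rewrite in_fsetU -!mcoeff_neq0 lcoefD lcoefZ.
apply: contraR; rewrite negb_or !negbK => /andP[/eqP-> /eqP->].
by rewrite scaler0 addr0.
Qed.

Lemma lextU x m : lext F (fmon x m) = F m x.
Proof.
rewrite (@lextEw [fset m]%fset) ?msuppU_le // big_seq_fset1.
by rewrite lcoefU eqxx.
Qed.
End Lext.

Lemma fsum_ext (K : fieldType) (I : choiceType) (V W : lmodType K)
    (f g : fsum I V -> W) : linear f -> linear g ->
  (forall x m, f (fmon x m) = g (fmon x m)) -> f =1 g.
Proof.
move=> fl gl fg; elim/fsum_ind => [|u v fu fv|//]; first by rewrite !lin0.
by rewrite !linD // fu fv.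
Qed.

Section Conv.
Context {K : fieldType} {I : choiceType} {U V W : lmodType K}.

(* The product with [x <m> * y <s> = (b m x y) <op m s>]. *)
Definition conv (op : I -> I -> I) (b : I -> U -> V -> W) (u : fsum I U) (v : fsum I V) :
    fsum I W :=
  lext (fun m x => lext (fun s y => fmon (b m x y) (op m s)) v) u.

Context (op : I -> I -> I) (b : I -> U -> V -> W).
Context (b_linl : forall m y, linear (fun x => b m x y)).
Context (b_linr : forall m x, linear (b m x)).

Let b_in_lin m x s : linear (fun y : V => fmon (b m x y) (op m s)).
Proof. by move=> a y z; rewrite b_linr fmon_lin. Qed.

Let b_out_lin v m : linear (fun x => lext (fun s y => fmon (b m x y) (op m s)) v).
Proof.
move=> a x y; elim/fsum_ind: v => [|v w IHv IHw|z s].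
- by rewrite !(lin0 (lext_lin _)) // scaler0 addr0.
- rewrite !(linD (lext_lin _)) // IHv IHw scalerDr !addrA; congr (_ + _).
  by rewrite addrAC.
- by rewrite !lextU // b_linl fmon_lin.
Qed.

Lemma conv_linl v : linear (conv op b ^~ v).
Proof. exact: lext_lin. Qed.

Lemma conv_linr u : linear (conv op b u).
Proof.
move=> a v w; elim/fsum_ind: u => [|u u' IHu IHu'|x m].
- by rewrite !(lin0 (conv_linl _)) scaler0 addr0.
- rewrite !(linD (conv_linl _)) IHu IHu' scalerDr !addrA; congr (_ + _).
  by rewrite addrAC.
- by rewrite /conv !lextU // lext_lin.
Qed.

Lemma convU x y m s : conv op b (fmon x m) (fmon y s) = fmon (b m x y) (op m s).
Proof. by rewrite /conv !lextU. Qed.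
End Conv.

Section Cmap.
Context {K : fieldType} {I : choiceType} {V W : lmodType K}.

(* The map with [x <m> |-> (F m x) <m>]. *)
Definition cmap (F : I -> V -> W) : fsum I V -> fsum I W :=
  lext (fun m x => fmon (F m x) m).

Context (F : I -> V -> W) (F_lin : forall m, linear (F m)).

Let F_lin' m : linear (fun x : V => fmon (F m x) m).
Proof. by move=> a x y; rewrite F_lin fmon_lin. Qed.

Lemma cmap_lin : linear (cmap F). Proof. exact: lext_lin. Qed.

Lemma cmapU x m : cmap F (fmon x m) = fmon (F m x) m.
Proof. by rewrite /cmap lextU. Qed.

Lemma cmapE u m : (cmap F u)@_m = F m u@_m.
Proof.
elim/fsum_ind: u => [|u v IHu IHv|x s].
- by rewrite (lin0 cmap_lin) !mcoeff0 (lin0 (F_lin m)).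
- by rewrite (linD cmap_lin) !lcoefD IHu IHv (linD (F_lin m)).
- by rewrite cmapU !lcoefU; case: eqP => [->|_] //; rewrite !mulr0n (lin0 (F_lin m)).
Qed.
End Cmap.


Notation Zn n := {ffun 'I_n -> int}.

(* [laurent n V] is [V (x) A]; [fmon w m] is [w (x) t^m]. *)
Definition laurent (n : nat) (V : zmodType) := fsum (Zn n) V.
HB.instance Definition _ (K : fieldType) (n : nat) (V : lmodType K) :=
  GRing.Lmodule.on (laurent n V).

Section Loop.
Context {K : fieldType} {n : nat} {L : lieAlgType K}.
Implicit Types u v w : laurent n L.

Definition loop_lie u v : laurent n L := conv +%R (fun=> @lie K L) u v.

Lemma loop_lieU x y m s : loop_lie (fmon x m) (fmon y s) = fmon (lie x y) (m + s).
Proof. by rewrite /loop_lie convU // => ? ?; [exact: lie_linl|exact: lie_linr]. Qed.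

Lemma loop_linl v : linear (loop_lie^~ v).
Proof. by apply: conv_linl => ? ?; [exact: lie_linl|exact: lie_linr]. Qed.
Lemma loop_linr u : linear (loop_lie u).
Proof. by apply: conv_linr => ? ?; [exact: lie_linl|exact: lie_linr]. Qed.

Lemma loop_lieC u v : loop_lie u v = - loop_lie v u.
Proof.
elim/fsum_ind: u => [|u u' IHu IHu'|x m].
- by rewrite (lin0 (loop_linl _)) (lin0 (loop_linr _)) oppr0.
- by rewrite (linD (loop_linl _)) (linD (loop_linr _)) IHu IHu' opprD.
elim/fsum_ind: v => [|v v' IHv IHv'|y s].
- by rewrite (lin0 (loop_linl _)) (lin0 (loop_linr _)) oppr0.
- by rewrite (linD (loop_linl _)) (linD (loop_linr _)) IHv IHv' opprD.
by rewrite !loop_lieU lieC addrC -scaleN1r -[RHS]scaleN1r (linZ (fmon_lin _)).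
Qed.

Lemma loop_liexx u : loop_lie u u = 0.
Proof.
elim/fsum_ind: u => [|u v uu vv|x m].
- exact: (lin0 (loop_linl _)).
- rewrite (linD (loop_linl _)) !(linD (loop_linr _)) uu vv add0r addr0.
  by rewrite loop_lieC addNr.
- by rewrite loop_lieU liexx (lin0 (fmon_lin _)).
Qed.

Lemma loop_jacobi u v w : loop_lie u (loop_lie v w) +
  loop_lie v (loop_lie w u) + loop_lie w (loop_lie u v) = 0.
Proof.
have shuffle (a b c a' b' c' : laurent n L) : a + b + c = 0 -> a' + b' + c' = 0 ->
    (a + a') + (b + b') + (c + c') = 0.
  by move=> e e'; rewrite (addrACA a) (addrACA (a + b)) e e' addr0.
elim/fsum_ind: u => [|u u' IHu IHu'|x m].
- by do ?rewrite (lin0 (loop_linl _)) ?(lin0 (loop_linr _)); rewrite !addr0.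
- rewrite !(linD (loop_linl _)) !(linD (loop_linr _)); exact: shuffle.
elim/fsum_ind: v => [|v v' IHv IHv'|y s].
- by do ?rewrite (lin0 (loop_linl _)) ?(lin0 (loop_linr _)); rewrite !addr0.
- rewrite !(linD (loop_linl _)) !(linD (loop_linr _)); exact: shuffle.
elim/fsum_ind: w => [|w w' IHw IHw'|z k].
- by do ?rewrite (lin0 (loop_linl _)) ?(lin0 (loop_linr _)); rewrite !addr0.
- rewrite !(linD (loop_linl _)) !(linD (loop_linr _)); exact: shuffle.
rewrite !loop_lieU (addrC s (k + m)) (addrC k (m + s)) -(addrA k) (addrC k (m + s)).
rewrite -(addrA m) -!(linD (fmon_lin _)) jacobi.
exact: (lin0 (fmon_lin _)).
Qed.

HB.instance Definition _ := Lmodule_isLie.Build K (laurent n L)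
  loop_linl loop_linr loop_liexx loop_jacobi.

Lemma loopU x y m s :
  lie (fmon x m : laurent n L) (fmon y s) = fmon (lie x y) (m + s).
Proof. exact: loop_lieU. Qed.
End Loop.

Definition laurentAlg (n : nat) (K : fieldType) := laurent n K^o.

Section LaurentAlg.
Context {K : fieldType} {n : nat}.
Implicit Types a b c : laurentAlg n K.

HB.instance Definition _ := GRing.Lmodule.on (laurentAlg n K).

Definition laurent_one : laurentAlg n K := fmon (1 : K^o) 0.
Definition laurent_mul a b : laurentAlg n K :=
  conv +%R (fun _ (x y : K^o) => x * y : K^o) a b.

Let mul_linl (y : K^o) : linear (fun x : K^o => x * y : K^o).
Proof. by move=> a x x'; rewrite mulrDl scalerAl. Qed.
Let mul_linr (x : K^o) : linear (fun y : K^o => x * y : K^o).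
Proof. by move=> a y y'; rewrite mulrDr scalerAr. Qed.

Lemma laurent_mulU (x y : K^o) m s :
  laurent_mul (fmon x m) (fmon y s) = fmon (x * y : K^o) (m + s).
Proof. by rewrite /laurent_mul convU. Qed.
Lemma laurent_mul_linl b : linear (laurent_mul^~ b).
Proof. by apply: conv_linl => ? ?; [exact: mul_linl|exact: mul_linr]. Qed.
Lemma laurent_mul_linr a : linear (laurent_mul a).
Proof. by apply: conv_linr => ? ?; [exact: mul_linl|exact: mul_linr]. Qed.

Lemma laurent_mulC : commutative laurent_mul.
Proof.
move=> a b; elim/fsum_ind: a => [|a a' IHa IHa'|x m].
- by rewrite (lin0 (laurent_mul_linl _)) (lin0 (laurent_mul_linr _)).
- by rewrite (linD (laurent_mul_linl _)) (linD (laurent_mul_linr _)) IHa IHa'.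
elim/fsum_ind: b => [|b b' IHb IHb'|y s].
- by rewrite (lin0 (laurent_mul_linl _)) (lin0 (laurent_mul_linr _)).
- by rewrite (linD (laurent_mul_linl _)) (linD (laurent_mul_linr _)) IHb IHb'.
by rewrite !laurent_mulU mulrC addrC.
Qed.

Lemma laurent_mulA : associative laurent_mul.
Proof.
move=> a b c; elim/fsum_ind: a => [|a a' IHa IHa'|x m].
- by rewrite !(lin0 (laurent_mul_linl _)).
- by rewrite !(linD (laurent_mul_linl _)) IHa IHa'.
elim/fsum_ind: b => [|b b' IHb IHb'|y s].
- by rewrite (lin0 (laurent_mul_linl _)) !(lin0 (laurent_mul_linr _)) (lin0 (laurent_mul_linl _)).
- by rewrite (linD (laurent_mul_linl _)) !(linD (laurent_mul_linr _))
    (linD (laurent_mul_linl _)) IHb IHb'.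
elim/fsum_ind: c => [|c c' IHc IHc'|z k].
- by rewrite !(lin0 (laurent_mul_linr _)).
- by rewrite !(linD (laurent_mul_linr _)) IHc IHc'.
by rewrite !laurent_mulU mulrA addrA.
Qed.

Lemma laurent_mul1 : left_id laurent_one laurent_mul.
Proof.
move=> a; elim/fsum_ind: a => [|a a' IHa IHa'|x m].
- exact: (lin0 (laurent_mul_linr _)).
- by rewrite (linD (laurent_mul_linr _)) IHa IHa'.
by rewrite laurent_mulU mul1r add0r.
Qed.
Lemma laurent_mulDl : left_distributive laurent_mul +%R.
Proof. by move=> a b c; rewrite (linD (laurent_mul_linl _)). Qed.
Lemma laurent_one_neq0 : laurent_one != 0.
Proof.
apply/eqP => /(congr1 (fun u : laurent n K^o => u@_0)).
by rewrite lcoefU eqxx mcoeff0 => /eqP; rewrite oner_eq0.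
Qed.

HB.instance Definition _ := GRing.Zmodule_isComNzRing.Build (laurentAlg n K)
  laurent_mulA laurent_mulC laurent_mul1 laurent_mulDl laurent_one_neq0.

Lemma fsum_scaleAl (k : K) a b : k *: (a * b) = (k *: a) * b.
Proof. by rewrite -[RHS]/(laurent_mul _ _) (linZ (laurent_mul_linl _)). Qed.
HB.instance Definition _ := GRing.Lmodule_isLalgebra.Build K (laurentAlg n K)
  fsum_scaleAl.
HB.instance Definition _ := GRing.Lalgebra_isComAlgebra.Build K (laurentAlg n K).
End LaurentAlg.


(* The free associative algebra on the set [L]: formal sums of words. *)
Definition freeAlg (K : fieldType) (L : lieAlgType K) := fsum (seq L) K^o.

Section FreeAlg.
Context {K : fieldType} {L : lieAlgType K}.
Implicit Types p q r : freeAlg L.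

HB.instance Definition _ := GRing.Lmodule.on (freeAlg L).

Definition free_one : freeAlg L := fmon (1 : K^o) [::].
Definition free_mul p q : freeAlg L :=
  conv cat (fun _ (x y : K^o) => x * y : K^o) p q.

Let mul_linl (y : K^o) : linear (fun x : K^o => x * y : K^o).
Proof. by move=> a x x'; rewrite mulrDl scalerAl. Qed.
Let mul_linr (x : K^o) : linear (fun y : K^o => x * y : K^o).
Proof. by move=> a y y'; rewrite mulrDr scalerAr. Qed.

Lemma free_mulU (x y : K^o) (s t : seq L) :
  free_mul (fmon x s) (fmon y t) = fmon (x * y : K^o) (s ++ t).
Proof. by rewrite /free_mul convU. Qed.
Lemma free_mul_linl q : linear (free_mul^~ q).
Proof. by apply: conv_linl => ? ?; [exact: mul_linl|exact: mul_linr]. Qed.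
Lemma free_mul_linr p : linear (free_mul p).
Proof. by apply: conv_linr => ? ?; [exact: mul_linl|exact: mul_linr]. Qed.

Lemma free_mulA : associative free_mul.
Proof.
move=> a b c; elim/fsum_ind: a => [|a a' IHa IHa'|x m].
- by rewrite !(lin0 (free_mul_linl _)).
- by rewrite !(linD (free_mul_linl _)) IHa IHa'.
elim/fsum_ind: b => [|b b' IHb IHb'|y s].
- by rewrite (lin0 (free_mul_linl _)) !(lin0 (free_mul_linr _)) (lin0 (free_mul_linl _)).
- rewrite (linD (free_mul_linl _)) !(linD (free_mul_linr _)).
  by rewrite (linD (free_mul_linl _)) IHb IHb'.
elim/fsum_ind: c => [|c c' IHc IHc'|z k].
- by rewrite !(lin0 (free_mul_linr _)).
- by rewrite !(linD (free_mul_linr _)) IHc IHc'.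
by rewrite !free_mulU mulrA catA.
Qed.
Lemma free_mul1 : left_id free_one free_mul.
Proof.
move=> a; elim/fsum_ind: a => [|a a' IHa IHa'|x m].
- exact: (lin0 (free_mul_linr _)).
- by rewrite (linD (free_mul_linr _)) IHa IHa'.
by rewrite free_mulU mul1r.
Qed.
Lemma free_mulr1 : right_id free_one free_mul.
Proof.
move=> a; elim/fsum_ind: a => [|a a' IHa IHa'|x m].
- exact: (lin0 (free_mul_linl _)).
- by rewrite (linD (free_mul_linl _)) IHa IHa'.
by rewrite free_mulU mulr1 cats0.
Qed.
Lemma free_mulDl : left_distributive free_mul +%R.
Proof. by move=> a b c; rewrite (linD (free_mul_linl _)). Qed.
Lemma free_mulDr : right_distributive free_mul +%R.
Proof. by move=> a b c; rewrite (linD (free_mul_linr _)). Qed.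
Lemma free_one_neq0 : free_one != 0.
Proof.
apply/eqP => /(congr1 (fun u : fsum (seq L) K^o => u@_[::])).
by rewrite lcoefU eqxx mcoeff0 => /eqP; rewrite oner_eq0.
Qed.
HB.instance Definition _ := GRing.Zmodule_isNzRing.Build (freeAlg L)
  free_mulA free_mul1 free_mulr1 free_mulDl free_mulDr free_one_neq0.

Lemma free_scaleAl (k : K) p q : k *: (p * q) = (k *: p) * q.
Proof. by rewrite -[RHS]/(free_mul _ _) (linZ (free_mul_linl _)). Qed.
Lemma free_scaleAr (k : K) p q : k *: (p * q) = p * (k *: q).
Proof. by rewrite -[RHS]/(free_mul _ _) (linZ (free_mul_linr _)). Qed.
HB.instance Definition _ := GRing.Lmodule_isLalgebra.Build K (freeAlg L) free_scaleAl.
HB.instance Definition _ := GRing.Lalgebra_isAlgebra.Build K (freeAlg L) free_scaleAr.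

Definition fgen (x : L) : freeAlg L := fmon (1 : K^o) [:: x].
End FreeAlg.

Definition envl_rel (K : fieldType) (L : lieAlgType K) : set (freeAlg L) :=
  [set p | (exists a x y, p = fgen (a *: x + y) - a *: fgen x - fgen y) \/
     (exists x y, p = fgen x * fgen y - fgen y * fgen x - fgen (lie x y))].

Definition envl_ideal (K : fieldType) (L : lieAlgType K) : {pred freeAlg L} :=
  lspan [set p | exists a b r, envl_rel r /\ p = a * r * b].
HB.instance Definition _ (K : fieldType) (L : lieAlgType K) :=
  GRing.SubmodClosed.on (@envl_ideal K L).

Definition envl (K : fieldType) (L : lieAlgType K) := lquot (@envl_ideal K L).

Section EnvlIdeal.
Context {K : fieldType} {L : lieAlgType K}.
Implicit Types p q r : freeAlg L.

Let envl_ideal_closed : submod_closed (@envl_ideal K L).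
Proof. exact: lspan_closed. Qed.

Lemma envl_idealM p q r : r \in @envl_ideal K L -> p * r * q \in @envl_ideal K L.
Proof.
pose S : {pred freeAlg L} := fun r => p * r * q \in @envl_ideal K L.
have SE u : (u \in S) = (p * u * q \in @envl_ideal K L) by [].
have S_closed : submod_closed S.
  split; rewrite ?SE ?mulr0 ?mul0r; first exact: envl_ideal_closed.1.
  move=> a u v; rewrite !SE => Su Sv.
  rewrite mulrDr mulrDl -free_scaleAr -scalerAl.
  exact: (envl_ideal_closed.2 a (p * u * q) (p * v * q) Su Sv).
pose Sm : submodClosed (freeAlg L) :=
  HB.pack S (GRing.isSubmodClosed.Build K (freeAlg L) S S_closed).
apply: (@lspan_min _ _ _ Sm) => _ [a [b [s [rs ->]]]].
rewrite -[_ \in _]/(_ \in @envl_ideal K L); apply: lspan_mem.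
by exists (p * a), (b * q), s; rewrite !mulrA.
Qed.

Lemma envl_idealMl p r : r \in @envl_ideal K L -> p * r \in @envl_ideal K L.
Proof. by move=> Ir; rewrite -[_ * _]mulr1 envl_idealM. Qed.
Lemma envl_idealMr q r : r \in @envl_ideal K L -> r * q \in @envl_ideal K L.
Proof. by move=> Ir; rewrite -[r]mul1r envl_idealM. Qed.
End EnvlIdeal.

Section FreeAction.
Context {K : fieldType} {L : lieAlgType K} {W : lmodType K}.
Variable rho : lieModule L W.

(* The word [x_1 ... x_k] acts as [rho x_1 \o ... \o rho x_k]. *)
Definition word_act (w : seq L) (v : W) : W := foldr rho v w.

Definition free_act (p : freeAlg L) (v : W) : W :=
  lext (fun w (c : K^o) => c *: word_act w v) p.

Lemma word_act_lin w : linear (word_act w).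
Proof.
move=> a u v; rewrite /word_act.
by elim: w => [|x s IHs] //=; rewrite IHs lact_linr.
Qed.

Let scale_lin w v : linear (fun c : K^o => c *: word_act w v).
Proof. by move=> a c d; rewrite scalerDl scalerA. Qed.

Lemma free_act_linl v : linear (free_act^~ v).
Proof. by apply: lext_lin => w; exact: scale_lin. Qed.

Lemma free_actU (c : K^o) w v : free_act (fmon c w) v = c *: word_act w v.
Proof. by rewrite /free_act lextU // => s; exact: scale_lin. Qed.

Lemma free_act_linr p : linear (free_act p).
Proof.
move=> a u v; elim/fsum_ind: p => [|p q IHp IHq|c w].
- by rewrite !(lin0 (free_act_linl _)) scaler0 addr0.
- by rewrite !(linD (free_act_linl _)) IHp IHq scalerDr addrACA.
by rewrite !free_actU word_act_lin scalerDr !scalerA mulrC.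
Qed.

Lemma free_act_gen x v : free_act (fgen x) v = rho x v.
Proof. by rewrite free_actU scale1r. Qed.

Lemma free_actM p q v : free_act (p * q) v = free_act p (free_act q v).
Proof.
elim/fsum_ind: p => [|p p' IH IH'|c w].
- by rewrite mul0r !(lin0 (free_act_linl _)).
- by rewrite mulrDl !(linD (free_act_linl _)) IH IH'.
elim/fsum_ind: q => [|q q' IH IH'|d w'].
- by rewrite mulr0 !(lin0 (free_act_linl _)) (lin0 (free_act_linr _)).
- by rewrite mulrDr !(linD (free_act_linl _)) (linD (free_act_linr _)) IH IH'.
rewrite -[_ * _]/(free_mul _ _) free_mulU !free_actU (linZ (word_act_lin _)) scalerA.
by rewrite /word_act foldr_cat.
Qed.

Lemma free_act_ideal p v : p \in @envl_ideal K L -> free_act p v = 0.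
Proof.
pose S : {pred freeAlg L} := fun p => `[< free_act p v = 0 >].
have S_closed : submod_closed S.
  split; first by apply/asboolP; exact: (lin0 (free_act_linl _)).
  move=> a p1 p2 /asboolP p10 /asboolP p20; apply/asboolP.
  by rewrite free_act_linl p10 p20 scaler0 addr0.
pose Sm : submodClosed (freeAlg L) :=
  HB.pack S (GRing.isSubmodClosed.Build K (freeAlg L) S S_closed).
move=> Ip; apply/asboolP; move: p Ip; apply: (@lspan_min _ _ _ Sm).
move=> _ [a [b [r [rr ->]]]]; apply/asboolP; rewrite !free_actM.
suff -> : free_act r (free_act b v) = 0 by exact: (lin0 (free_act_linr _)).
case: rr => [[c [x [y ->]]]|[x [y ->]]].
  rewrite !(linB (free_act_linl _)) (linZ (free_act_linl _)) !free_act_gen.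
  by rewrite lact_linl addrAC addrK subrr.
by rewrite !(linB (free_act_linl _)) !free_actM !free_act_gen lact_lie subrr.
Qed.
End FreeAction.

Section Trivial.
Context {K : fieldType} {L : lieAlgType K}.
Let triv_act (x : L) (v : K^o) : K^o := 0.
Let triv_linl v : linear (triv_act^~ v).
Proof. by move=> a u w; apply/esym/eqP; rewrite addr0 scaler_eq0 eqxx orbT. Qed.
Let triv_linr x : linear (triv_act x).
Proof. by move=> a u w; apply/esym/eqP; rewrite addr0 scaler_eq0 eqxx orbT. Qed.
Let triv_lie x y v :
  triv_act (lie x y) v = triv_act x (triv_act y v) - triv_act y (triv_act x v).
Proof. by rewrite /triv_act subr0. Qed.
Definition trivialModule : lieModule L K^o := LieModule triv_linl triv_linr triv_lie.

Lemma envl_ideal1 : 1 \notin @envl_ideal K L.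
Proof.
apply/negP => /(free_act_ideal trivialModule (1 : K^o)) /eqP.
by rewrite free_actU scale1r oner_eq0.
Qed.
End Trivial.

Section Envl.
Context {K : fieldType} {L : lieAlgType K}.
Implicit Types p q : freeAlg L.

HB.instance Definition _ := GRing.Lmodule.on (envl L).

Definition envl_pi p : envl L := lpi (@envl_ideal K L) p.
Definition envl_repr (u : envl L) : freeAlg L := lrepr (@envl_ideal K L) u.

Lemma envl_reprK u : envl_pi (envl_repr u) = u. Proof. exact: lreprK. Qed.
Lemma envl_piP p q : reflect (envl_pi p = envl_pi q) (p - q \in @envl_ideal K L).
Proof. exact: lpiP. Qed.
Lemma envl_pi_lin : linear envl_pi. Proof. exact: lpi_is_linear. Qed.

Definition envl_one : envl L := envl_pi 1.
Definition envl_mul (u v : envl L) : envl L := envl_pi (envl_repr u * envl_repr v).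

Lemma envl_mulE p q : envl_mul (envl_pi p) (envl_pi q) = envl_pi (p * q).
Proof.
set p' := envl_repr (envl_pi p); set q' := envl_repr (envl_pi q).
have Ip : p' - p \in @envl_ideal K L by apply/envl_piP; rewrite envl_reprK.
have Iq : q' - q \in @envl_ideal K L by apply/envl_piP; rewrite envl_reprK.
apply/envl_piP; rewrite -/p' -/q'.
have -> : p' * q' - p * q = (p' - p) * q' + p * (q' - q).
  by rewrite mulrBl mulrBr addrA subrK.
by apply: rpredD; [exact: envl_idealMr|exact: envl_idealMl].
Qed.

Lemma envl_mulA : associative envl_mul.
Proof.
move=> u v w; rewrite -[u]envl_reprK -[v]envl_reprK -[w]envl_reprK.
by rewrite !envl_mulE mulrA.
Qed.
Lemma envl_mul1 : left_id envl_one envl_mul.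
Proof. by move=> u; rewrite -[u]envl_reprK envl_mulE mul1r. Qed.
Lemma envl_mulr1 : right_id envl_one envl_mul.
Proof. by move=> u; rewrite -[u]envl_reprK envl_mulE mulr1. Qed.
Lemma envl_mulDl : left_distributive envl_mul +%R.
Proof.
move=> u v w; rewrite -[u]envl_reprK -[v]envl_reprK -[w]envl_reprK.
rewrite -(linD envl_pi_lin) !envl_mulE mulrDl; exact: (linD envl_pi_lin).
Qed.
Lemma envl_mulDr : right_distributive envl_mul +%R.
Proof.
move=> u v w; rewrite -[u]envl_reprK -[v]envl_reprK -[w]envl_reprK.
rewrite -(linD envl_pi_lin) !envl_mulE mulrDr; exact: (linD envl_pi_lin).
Qed.
Lemma envl_one_neq0 : envl_one != 0.
Proof.
by rewrite -(lin0 envl_pi_lin); apply/eqP => /envl_piP; rewrite subr0; apply/negP/envl_ideal1.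
Qed.
HB.instance Definition _ := GRing.Zmodule_isNzRing.Build (envl L)
  envl_mulA envl_mul1 envl_mulr1 envl_mulDl envl_mulDr envl_one_neq0.

Lemma envl_piM p q : envl_pi (p * q) = envl_pi p * envl_pi q.
Proof. by rewrite -[RHS]/(envl_mul _ _) envl_mulE. Qed.

Lemma envl_scaleAl (a : K) (u v : envl L) : a *: (u * v) = (a *: u) * v.
Proof.
rewrite -[u]envl_reprK -[v]envl_reprK.
rewrite -envl_piM -(linZ envl_pi_lin) -(linZ envl_pi_lin a (envl_repr u)).
by rewrite -envl_piM scalerAl.
Qed.
Lemma envl_scaleAr (a : K) (u v : envl L) : a *: (u * v) = u * (a *: v).
Proof.
rewrite -[u]envl_reprK -[v]envl_reprK.
rewrite -envl_piM -(linZ envl_pi_lin) -(linZ envl_pi_lin a (envl_repr v)).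
by rewrite -envl_piM scalerAr.
Qed.
HB.instance Definition _ := GRing.Lmodule_isLalgebra.Build K (envl L) envl_scaleAl.
HB.instance Definition _ := GRing.Lalgebra_isAlgebra.Build K (envl L) envl_scaleAr.

Definition iota (x : L) : envl L := envl_pi (fgen x).

Lemma iota_lin : linear iota.
Proof.
move=> a x y; rewrite /iota -envl_pi_lin; apply/envl_piP.
apply: lspan_mem; exists 1, 1, (fgen (a *: x + y) - a *: fgen x - fgen y).
by split; [left; exists a, x, y|rewrite mul1r mulr1 opprD addrA].
Qed.

Lemma iota_lie x y : iota (lie x y) = iota x * iota y - iota y * iota x.
Proof.
rewrite -!envl_piM.
rewrite -(linB envl_pi_lin); apply/esym/envl_piP; apply: lspan_mem.
exists 1, 1, (fgen x * fgen y - fgen y * fgen x - fgen (lie x y)).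
by split; [right; exists x, y|rewrite mul1r mulr1].
Qed.
End Envl.

Section EnvlAction.
Context {K : fieldType} {L : lieAlgType K} {W : lmodType K}.
Variable rho : lieModule L W.

(* The action of [U(L)] extending that of [L]. *)
Definition uact (u : envl L) (v : W) : W := free_act rho (envl_repr u) v.

Lemma uact_pi p v : uact (envl_pi p) v = free_act rho p v.
Proof.
apply/eqP; rewrite -subr_eq0 -(linB (free_act_linl _ _)); apply/eqP.
by apply: free_act_ideal; apply/envl_piP; rewrite envl_reprK.
Qed.

Lemma uact_iota x v : uact (iota x) v = rho x v.
Proof. by rewrite uact_pi free_act_gen. Qed.
Lemma uact1 v : uact 1 v = v.
Proof. by rewrite uact_pi free_actU scale1r. Qed.
Lemma uactM u u' v : uact (u * u') v = uact u (uact u' v).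
Proof.
rewrite -[u]envl_reprK -[u']envl_reprK -envl_piM.
by rewrite !uact_pi free_actM.
Qed.
Lemma uact_linl v : linear (uact^~ v).
Proof.
move=> a u u'; rewrite -[u]envl_reprK -[u']envl_reprK -envl_pi_lin !uact_pi.
exact: free_act_linl.
Qed.
Lemma uact_linr u : linear (uact u). Proof. exact: free_act_linr. Qed.
End EnvlAction.

(* A linear map [L -> B] turning brackets into commutators. *)
Record lieAlgMap (K : fieldType) (L : lieAlgType K) (B : algType K) := LieAlgMap {
  lam :> L -> B;
  lam_lin : linear lam;
  lam_lie : forall x y, lam (lie x y) = lam x * lam y - lam y * lam x
}.

Section EnvlLift.
Context {K : fieldType} {L : lieAlgType K} {B : algType K}.
Variable f : lieAlgMap L B.

Let mul_act (x : L) (b : B) : B := f x * b.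
Let mul_linl b : linear (mul_act^~ b).
Proof. by move=> a x y; rewrite /mul_act lam_lin mulrDl scalerAl. Qed.
Let mul_linr x : linear (mul_act x).
Proof. by move=> a b c; rewrite /mul_act mulrDr scalerAr. Qed.
Let mul_lie x y b :
  mul_act (lie x y) b = mul_act x (mul_act y b) - mul_act y (mul_act x b).
Proof. by rewrite /mul_act lam_lie mulrBl !mulrA. Qed.
Let mulModule : lieModule L B := LieModule mul_linl mul_linr mul_lie.

(* The algebra homomorphism [U(L) -> B] extending [f], obtained from the
   action of [U(L)] on the [L]-module [B] where [x] multiplies by [f x]. *)
Definition envl_lift (u : envl L) : B := uact mulModule u 1.

Let uact_mulr u b c : uact mulModule u (b * c) = uact mulModule u b * c.
Proof.
rewrite -[u]envl_reprK !uact_pi.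
elim/fsum_ind: (envl_repr u) => [|p p' IH IH'|a w].
- by rewrite !(lin0 (free_act_linl _ _)) mul0r.
- by rewrite !(linD (free_act_linl _ _)) IH IH' mulrDl.
rewrite !free_actU -scalerAl; congr (_ *: _).
by rewrite /word_act; elim: w => //= x s ->; rewrite /mul_act mulrA.
Qed.

Lemma envl_lift_iota x : envl_lift (iota x) = f x.
Proof. by rewrite /envl_lift uact_iota /= /mul_act mulr1. Qed.
Lemma envl_lift_lin : linear envl_lift. Proof. exact: uact_linl. Qed.
Lemma envl_lift_monoid : monoid_morphism envl_lift.
Proof.
split; first exact: uact1.
by move=> u v; rewrite /envl_lift uactM -{1}[uact _ v 1]mul1r uact_mulr.
Qed.
HB.instance Definition _ := GRing.isLinear.Build K (envl L) B _ envl_lift envl_lift_lin.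
HB.instance Definition _ := GRing.isMonoidMorphism.Build (envl L) B envl_lift
  envl_lift_monoid.
End EnvlLift.


Record derivAct (K : fieldType) (H : lmodType K) (L : lieAlgType K) := DerivAct {
  dact :> H -> L -> L;
  dact_linl : forall x, linear (dact^~ x);
  dact_linr : forall h, linear (dact h);
  dact_lie : forall h x y, dact h (lie x y) = lie (dact h x) y + lie x (dact h y);
  dact_comm : forall h k x, dact h (dact k x) = dact k (dact h x)
}.

Definition sdprod (K : fieldType) (H : lmodType K) (L : lieAlgType K)
  (delta : derivAct H L) : Type := (L * H)%type.

Section Sdprod.
Context {K : fieldType} {H : lmodType K} {L : lieAlgType K}.
Context {delta : derivAct H L}.
Implicit Types p q r : sdprod delta.

HB.instance Definition _ := GRing.Lmodule.on (sdprod delta).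

Definition sd_lie p q : sdprod delta :=
  (lie p.1 q.1 + delta p.2 q.1 - delta q.2 p.1, 0).

Lemma sd_linl q : linear (sd_lie^~ q).
Proof.
move=> a p p'; congr pair; last by rewrite /= scaler0 addr0.
rewrite /= lie_linl dact_linl dact_linr scalerBr scalerDr opprD.
by rewrite [LHS](AC (2*2*2) ((1*3*5)*(2*4*6))).
Qed.
Lemma sd_linr p : linear (sd_lie p).
Proof.
move=> a q q'; congr pair; last by rewrite /= scaler0 addr0.
rewrite /= lie_linr dact_linl dact_linr scalerBr scalerDr opprD.
by rewrite [LHS](AC (2*2*2) ((1*3*5)*(2*4*6))).
Qed.
Lemma sd_liexx p : sd_lie p p = 0.
Proof. by congr pair; rewrite liexx add0r subrr. Qed.

Lemma sd_jacobi p q r :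
  sd_lie p (sd_lie q r) + sd_lie q (sd_lie r p) + sd_lie r (sd_lie p q) = 0.
Proof.
case: p q r => [x a] [y b] [z c]; congr pair; last by rewrite /= !addr0.
have d0 u : delta 0 u = 0 by exact: (lin0 (dact_linl delta u)).
have E (u v w : L) (d e f : H) :
    lie u (lie v w + delta e w - delta f v) + delta d (lie v w + delta e w - delta f v) =
    lie u (lie v w) +
    (lie u (delta e w) - lie u (delta f v) - lie w (delta d v) + lie v (delta d w))
    + (delta d (delta e w) - delta d (delta f v)).
  rewrite !(linB (lie_linr u)) !(linD (lie_linr u)) !(linB (dact_linr delta d)).
  rewrite !(linD (dact_linr delta d)) dact_lie (lieC (delta d v) w).
  by rewrite [LHS](AC (3*(2*1*1)) (1*(2*3*4*5)*(6*7))).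
rewrite /= !d0 !subr0 !E.
move: (jacobi x y z) => J.
rewrite (dact_comm delta b a z) (dact_comm delta c a y) (dact_comm delta c b x).
rewrite [LHS](AC (3*3*3) ((1*4*7)*(2*5*8)*(3*6*9))) /= J add0r.
set t1 := lie x (delta b z); set t2 := lie x (delta c y).
set t3 := lie z (delta a y); set t4 := lie y (delta a z).
set t5 := lie y (delta c x); set t6 := lie z (delta b x).
rewrite [X in X + _](AC (4*4*4) ((1*7)*(2*12)*(3*9)*(4*6)*(5*11)*(8*10))) /=.
rewrite !subrr !addNr !addr0 add0r.
by rewrite [LHS](AC (2*2*2) ((1*4)*(2*5)*(3*6))) /= !subrr !addNr !addr0.
Qed.

HB.instance Definition _ := Lmodule_isLie.Build K (sdprod delta)
  sd_linl sd_linr sd_liexx sd_jacobi.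
End Sdprod.


Definition is_gcm (l : nat) (A : 'M[int]_l) : Prop :=
  [/\ forall i, A i i = 2%:Z,
      forall i j, i != j -> (A i j <= 0)%R
    & forall i j, A i j = 0 -> A j i = 0].

Definition is_realization (K : fieldType) (l : nat) (A : 'M[int]_l)
    (h : vectType K) (alpha : l.-tuple 'Hom(h, K^o)) (alphav : l.-tuple h) : Prop :=
  [/\ free alpha, free alphav,
      forall i j, tnth alpha j (tnth alphav i) = (A i j)%:~R
    & (\dim {:h} + \rank (map_mx intr A : 'M[K]_l) = l.*2)%N].

(* The Kac-Moody algebra [g(A)]: the Lie algebra generated by [h], [e_i], [f_i]
   subject to the Chevalley relations, modulo its largest ideal meeting [h]
   trivially.  [km_in] is the inclusion of [h] in [g]. *)
Record kacMoody (K : fieldType) := KacMoody {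
  km_rank : nat;
  km_gcm : 'M[int]_km_rank;
  km_gcmP : is_gcm km_gcm;
  km_h : vectType K;
  km_alpha : km_rank.-tuple 'Hom(km_h, K^o);
  km_alphav : km_rank.-tuple km_h;
  km_realization : is_realization km_gcm km_alpha km_alphav;
  km_alg :> lieAlgType K;
  km_in : km_h -> km_alg;
  km_in_lin : linear km_in;
  km_in_inj : injective km_in;
  km_e : 'I_km_rank -> km_alg;
  km_f : 'I_km_rank -> km_alg;
  km_ef : forall i j,
    lie (km_e i) (km_f j) = if i == j then km_in (tnth km_alphav i) else 0;
  km_hh : forall x y, lie (km_in x) (km_in y) = 0;
  km_he : forall x i, lie (km_in x) (km_e i) = (tnth km_alpha i x : K) *: km_e i;
  km_hf : forall x i, lie (km_in x) (km_f i) = - (tnth km_alpha i x : K) *: km_f i;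
  km_gen : lie_gen (range km_in `|` range km_e `|` range km_f) = setT;
  km_noideal : forall S : submodClosed km_alg, lie_ideal S ->
    (forall x, km_in x \in S -> x = 0) -> forall y, y \in S -> y = 0
}.

Section CurrentAlgebra.
Context {K : fieldType} (G : kacMoody K).
Local Notation h := (km_h G).
Local Notation g' := (derivedAlg G).

Definition km_nplus : set G := lie_gen (range (@km_e K G)).

(* h', as a subspace of h rather than of g'. *)
Definition hprime : {pred h} := fun x => km_in x \in @derived K G.

Lemma hprime_closed : submod_closed hprime.
Proof.
split; first by rewrite unfold_in (lin0 (@km_in_lin K G)) rpred0.
by move=> a x y; rewrite !unfold_in km_in_lin; exact: (lspan_closed _).2.
Qed.
HB.instance Definition _ := GRing.isSubmodClosed.Build K h hprime hprime_closed.

Definition is_complement (H2 : submodClosed h) : Prop :=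
  (forall x, exists2 y, y \in hprime & x - y \in H2) /\
  (forall x, x \in hprime -> x \in H2 -> x = 0).

Definition hprime_in (x : subm hprime) : g' := Sub (km_in (val x)) (valP x).

Context (n : nat) (H2 : submodClosed h).

(* [X (x) t^m |-> [h, X] (x) t^m] *)
Definition hsec_der (x : subm H2) : laurent n g' -> laurent n g' :=
  cmap (fun _ => derived_ad (km_in (val x))).

Let ad_linl (y : g') : linear (fun x : subm H2 => derived_ad (km_in (val x)) y).
Proof.
move=> a u v; apply: val_inj; rewrite /= -lie_linl; congr (lie _ _).
exact: km_in_lin.
Qed.
Let ad_linr (x : G) : linear (@derived_ad K G x).
Proof. by move=> a u v; apply: val_inj; exact: lie_linr. Qed.
Let ad_lie (x : G) (y z : g') :
  derived_ad x (lie y z) = lie (derived_ad x y) z + lie y (derived_ad x z).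
Proof. by apply: val_inj; exact: lie_leibniz. Qed.
Let ad_comm (x x' : subm H2) (y : g') :
  derived_ad (km_in (val x)) (derived_ad (km_in (val x')) y) =
  derived_ad (km_in (val x')) (derived_ad (km_in (val x)) y).
Proof.
apply: val_inj; rewrite /= lie_leibniz km_hh.
by rewrite (lin0 (lie_linl _)) add0r.
Qed.

Lemma hsec_derU x y m :
  hsec_der x (fmon y m) = fmon (derived_ad (km_in (val x)) y) m.
Proof. by rewrite /hsec_der cmapU. Qed.
Lemma hsec_der_linr x : linear (hsec_der x).
Proof. exact: cmap_lin. Qed.
Lemma hsec_der_linl u : linear (hsec_der^~ u).
Proof.
move=> a x y; elim/fsum_ind: u => [|u v IHu IHv|z m].
- by rewrite !(lin0 (hsec_der_linr _)) scaler0 addr0.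
- by rewrite !(linD (hsec_der_linr _)) IHu IHv scalerDr addrACA.
by rewrite !hsec_derU ad_linl fmon_lin.
Qed.
Lemma hsec_der0 u : hsec_der 0 u = 0.
Proof. exact: (lin0 (hsec_der_linl u)). Qed.
Lemma hsec_der_lie x u v :
  hsec_der x (lie u v) = lie (hsec_der x u) v + lie u (hsec_der x v).
Proof.
elim/fsum_ind: u => [|u u' IHu IHu'|y m].
- by rewrite (lin0 (hsec_der_linr _)) !(lin0 (lie_linl _))
    (lin0 (hsec_der_linr _)) addr0.
- rewrite (linD (hsec_der_linr x) u) !(linD (lie_linl _)).
  rewrite (linD (hsec_der_linr _)).
  exact: etrans (congr2 +%R IHu IHu') (addrACA _ _ _ _).
elim/fsum_ind: v => [|v v' IHv IHv'|z s].
- by rewrite (lin0 (hsec_der_linr _)) !(lin0 (lie_linr _))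
    (lin0 (hsec_der_linr _)) addr0.
- rewrite (linD (hsec_der_linr x) v) !(linD (lie_linr _)).
  rewrite (linD (hsec_der_linr _)).
  exact: etrans (congr2 +%R IHv IHv') (addrACA _ _ _ _).
by rewrite !hsec_derU !loopU hsec_derU ad_lie (linD (fmon_lin _)).
Qed.
Lemma hsec_der_comm x y u : hsec_der x (hsec_der y u) = hsec_der y (hsec_der x u).
Proof.
elim/fsum_ind: u => [|u v IHu IHv|z m].
- by rewrite !(lin0 (hsec_der_linr _)).
- by rewrite !(linD (hsec_der_linr _)) IHu IHv.
by rewrite !hsec_derU ad_comm.
Qed.
Definition hsec_act : derivAct (subm H2) (laurent n g') :=
  DerivAct hsec_der_linl hsec_der_linr hsec_der_lie hsec_der_comm.

(* The bracket of [g_A = (g' (x) A) (+) h''] is read off [hsec_act]. *)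
Definition gA := sdprod hsec_act.
HB.instance Definition _ := LieAlgebra.on gA.

Definition loop_in (u : laurent n g') : gA := (u, 0).
Definition hsec_in (x : subm H2) : gA := (0, x).

Definition ddot (d : 'rV[K]_n) (m : Zn n) : K := \sum_i d 0 i * (m i)%:~R.

Lemma ddot_linl m : linear (fun d => ddot d m : K^o).
Proof.
move=> a d d'; rewrite /ddot scaler_sumr -big_split /=.
by apply: eq_bigr => i _; rewrite !mxE mulrDl -mulrA.
Qed.
Lemma ddotD d m s : ddot d (m + s) = ddot d m + ddot d s.
Proof.
rewrite /ddot -big_split /=; apply: eq_bigr => i _.
by rewrite ffunE intrD mulrDr.
Qed.

(* [sum_i d_i (t_i d/dt_i)] on [V (x) A]. *)
Definition deg_der (V : lmodType K) (d : 'rV[K]_n) : laurent n V -> laurent n V :=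
  cmap (fun m x => ddot d m *: x).

Section DegDer.
Context {V : lmodType K}.
Implicit Types (d : 'rV[K]_n) (u : laurent n V).

Let sc_lin d m : linear (fun x : V => ddot d m *: x).
Proof. by move=> a x y; rewrite scalerDr !scalerA mulrC. Qed.

Lemma deg_derU d (x : V) m : deg_der d (fmon x m) = ddot d m *: fmon x m.
Proof. by rewrite /deg_der cmapU // (linZ (fmon_lin _)). Qed.
Lemma deg_der_linr d : linear (@deg_der V d).
Proof. exact: cmap_lin. Qed.
Lemma deg_der_linl u : linear (@deg_der V ^~ u).
Proof.
move=> a x y; elim/fsum_ind: u => [|u v IHu IHv|z m].
- by rewrite !(lin0 (deg_der_linr _)) scaler0 addr0.
- rewrite (linD (deg_der_linr (_ + _))) (linD (deg_der_linr x)).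
  by rewrite (linD (deg_der_linr y)) scalerDr addrACA; exact: (congr2 +%R IHu IHv).
by rewrite !deg_derU ddot_linl scalerDl scalerA.
Qed.
Lemma deg_der_comm d d' u : deg_der d (deg_der d' u) = deg_der d' (deg_der d u).
Proof.
elim/fsum_ind: u => [|u v IHu IHv|z m].
- by rewrite !(lin0 (deg_der_linr _)).
- by rewrite !(linD (deg_der_linr _)) IHu IHv.
rewrite !deg_derU !(linZ (deg_der_linr _)) !deg_derU !scalerA.
by rewrite [X in X *: _]mulrC.
Qed.
End DegDer.

Definition D_der (d : 'rV[K]_n) (p : gA) : gA := loop_in (deg_der d p.1).

Lemma D_der_linl p : linear (D_der^~ p).
Proof. by move=> a d d'; congr pair; [exact: deg_der_linl|rewrite /= scaler0 addr0]. Qed.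
Lemma D_der_linr d : linear (D_der d).
Proof. by move=> a p q; congr pair; [exact: deg_der_linr|rewrite /= scaler0 addr0]. Qed.
Lemma D_der_comm d d' p : D_der d (D_der d' p) = D_der d' (D_der d p).
Proof. by rewrite /D_der /loop_in /= deg_der_comm. Qed.

Lemma deg_der_lie d (u v : laurent n g') :
  deg_der d (lie u v) = lie (deg_der d u) v + lie u (deg_der d v).
Proof.
elim/fsum_ind: u => [|u u' IHu IHu'|y m].
- by rewrite (lin0 (deg_der_linr _)) !(lin0 (lie_linl _))
    (lin0 (deg_der_linr _)) addr0.
- rewrite (linD (deg_der_linr d) u) !(linD (lie_linl _)).
  rewrite (linD (deg_der_linr _)).
  exact: etrans (congr2 +%R IHu IHu') (addrACA _ _ _ _).
elim/fsum_ind: v => [|v v' IHv IHv'|z s].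
- by rewrite (lin0 (deg_der_linr _)) !(lin0 (lie_linr _))
    (lin0 (deg_der_linr _)) addr0.
- rewrite (linD (deg_der_linr d) v) !(linD (lie_linr _)).
  rewrite (linD (deg_der_linr _)).
  exact: etrans (congr2 +%R IHv IHv') (addrACA _ _ _ _).
rewrite !deg_derU (linZ (lie_linl _)) (linZ (lie_linr _)) !loopU deg_derU.
by rewrite ddotD scalerDl.
Qed.
Lemma deg_hsec d x (u : laurent n g') :
  deg_der d (hsec_der x u) = hsec_der x (deg_der d u).
Proof.
elim/fsum_ind: u => [|u v IHu IHv|z m].
- by rewrite !(lin0 (deg_der_linr _), lin0 (hsec_der_linr _)).
- by rewrite !(linD (deg_der_linr _), linD (hsec_der_linr _)) IHu IHv.
by rewrite deg_derU hsec_derU deg_derU (linZ (hsec_der_linr _)) hsec_derU.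
Qed.
Lemma D_der_lie d (p q : gA) : D_der d (lie p q) = lie (D_der d p) q + lie p (D_der d q).
Proof.
have h0 u : hsec_der 0 u = 0 by exact: (lin0 (hsec_der_linl u)).
congr pair; last by rewrite /= addr0.
simpl.
rewrite (h0 q.1).
rewrite (h0 p.1).
rewrite [X in _ = _ + X]subr0 [X in _ = X - _ + _]addr0.
rewrite (linB (deg_der_linr d)) (linD (deg_der_linr d)).
rewrite deg_der_lie !deg_hsec.
by rewrite [LHS](AC (2*1*1) ((1*4)*(2*3))) /=.
Qed.
Definition D_act : derivAct 'rV[K]_n gA :=
  DerivAct D_der_linl D_der_linr D_der_lie D_der_comm.

(* [g_A (+) D], with [d_i] the i-th basis vector of ['rV[K]_n]. *)
Definition gAt := sdprod D_act.
HB.instance Definition _ := LieAlgebra.on gAt.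

End CurrentAlgebra.


Definition irreducible_module (K : fieldType) (L : lieAlgType K) (V : lmodType K)
    (rho : lieModule L V) : Prop :=
  (exists v : V, v <> 0) /\
  forall S : submodClosed V, (forall x v, v \in S -> rho x v \in S) ->
    (forall v, v \in S -> v = 0) \/ (forall v, v \in S).

Section HighestWeight.
Context {K : fieldType} {G : kacMoody K} {n : nat} {H2 : submodClosed (km_h G)}.
Local Notation h := (km_h G).
Local Notation g' := (derivedAlg G).
Local Notation h' := (subm (@hprime K G)).
Local Notation h'' := (subm H2).
Local Notation g_A := (gA n H2).

Definition hA : lmodType K := (laurent n h' * h'')%type.

Definition hA_in (y : hA) : g_A := (cmap (fun _ => @hprime_in K G) y.1, y.2).

Definition nA : set g_A :=
  [set x | x.2 = 0 /\ forall m, @km_nplus K G (val (x.1)@_m)].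

Section Verma.
Context (psi : {linear hA -> K^o}).

(* [M(psi) = U(g_A) (x)_{U(b)} C] with [b = (N^+ (x) A) (+) h_A]: the quotient
   of [U(g_A)] by the span of the [u b - chi(b) u], where [chi] is the character
   by which [b] acts on [C]. *)
Definition verma_rel : set (envl g_A) :=
  [set z | (exists (u : envl g_A) x, nA x /\ z = u * iota x) \/
     (exists (u : envl g_A) y, z = u * iota (hA_in y) - (psi y : K) *: u)].

Definition verma := lquot (lspan verma_rel).
HB.instance Definition _ := GRing.Lmodule.on verma.

Definition verma_pi (u : envl g_A) : verma := lpi (lspan verma_rel) u.

Lemma verma_pi_lin : linear verma_pi. Proof. exact: lpi_is_linear. Qed.

Lemma verma_relM (u z : envl g_A) :
  z \in lspan verma_rel -> u * z \in lspan verma_rel.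
Proof.
pose S : {pred envl g_A} := fun z => u * z \in lspan verma_rel.
have SE w : (w \in S) = (u * w \in lspan verma_rel) by [].
have M_closed : submod_closed (lspan verma_rel) by exact: lspan_closed.
have S_closed : submod_closed S.
  split; rewrite ?SE; first by rewrite mulr0; exact: M_closed.1.
  move=> a v w; rewrite !SE => Sv Sw; rewrite mulrDr -scalerAr.
  exact: (M_closed.2 a (u * v) (u * w) Sv Sw).
pose Sm : submodClosed (envl g_A) :=
  HB.pack S (GRing.isSubmodClosed.Build K (envl g_A) S S_closed).
apply: (@lspan_min _ _ _ Sm) => {}z; rewrite -[_ \in _]/(u * z \in _).
case=> [[w [x [nx ->]]]|[w [y ->]]]; apply: lspan_mem.
  by left; exists (u * w), x; rewrite mulrA.
by right; exists (u * w), y; rewrite mulrBr mulrA scalerAr.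
Qed.

Definition verma_act (x : g_A) (q : verma) : verma :=
  verma_pi (iota x * lrepr _ q).

Lemma verma_actE x u : verma_act x (verma_pi u) = verma_pi (iota x * u).
Proof.
by apply/lpiP; rewrite -mulrBr; apply: verma_relM; apply/lpiP; rewrite lreprK.
Qed.

Lemma verma_act_linl q : linear (verma_act^~ q).
Proof.
move=> a x y; rewrite /verma_act iota_lin mulrDl -scalerAl.
exact: verma_pi_lin.
Qed.
Lemma verma_act_linr x : linear (verma_act x).
Proof.
move=> a p q; rewrite -[p]lreprK -[q]lreprK -!/(verma_pi _) -verma_pi_lin.
by rewrite !verma_actE mulrDr -scalerAr verma_pi_lin.
Qed.
Lemma verma_act_lie x y q :
  verma_act (lie x y) q = verma_act x (verma_act y q) - verma_act y (verma_act x q).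
Proof.
rewrite -[q]lreprK -!/(verma_pi _) !verma_actE -(linB verma_pi_lin) iota_lie.
have E (R : nzRingType) (a b c : R) : (a * b - b * a) * c = a * (b * c) - b * (a * c).
  by rewrite mulrBl !mulrA.
by rewrite E.
Qed.
Definition vermaModule : lieModule g_A verma :=
  LieModule verma_act_linl verma_act_linr verma_act_lie.

(* The image of [1 (x) 1]. *)
Definition verma_vec : verma := verma_pi 1.

(* [V(psi)]: an irreducible quotient of [M(psi)], unique up to isomorphism. *)
Record irrQuotient := IrrQuotient {
  irr_car :> lmodType K;
  irr_act : lieModule g_A irr_car;
  irr_pi : verma -> irr_car;
  irr_pi_lin : linear irr_pi;
  irr_pi_act : forall x q, irr_pi (vermaModule x q) = irr_act x (irr_pi q);
  irr_pi_surj : forall w, exists q, irr_pi q = w;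
  irr_irr : irreducible_module irr_act
}.

Definition highest_weight_vector (V : irrQuotient) (v : V) : Prop :=
  exists2 c : K, c != 0 & v = c *: irr_pi V verma_vec.

Definition psi_mon (u : abelianLie (laurent n h')) : laurentAlg n K :=
  cmap (fun m x => psi (fmon x m, 0)) u.

Let psi_mon_in m : linear (fun x : h' => psi (fmon x m, 0) : K^o).
Proof.
move=> a x y; rewrite -linearP; congr (psi (_, _)); first exact: fmon_lin.
by rewrite /= scaler0 addr0.
Qed.
Lemma psi_mon_lin : linear psi_mon.
Proof. exact: cmap_lin. Qed.
Lemma psi_monU x m : psi_mon (fmon x m) = fmon (psi (fmon x m, 0)) m.
Proof. exact: cmapU. Qed.
Lemma psi_mon_lie u v :
  psi_mon (lie u v) = psi_mon u * psi_mon v - psi_mon v * psi_mon u.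
Proof.
have E (R : comNzRingType) (a b : R) : a * b - b * a = 0 by rewrite mulrC subrr.
by rewrite E; exact: (lin0 psi_mon_lin).
Qed.
Definition psi_map := LieAlgMap psi_mon_lin psi_mon_lie.

(* The Lie algebra [h' (x) A] is abelian, since h' is. *)
Definition Apsi : set (laurentAlg n K) := range (envl_lift psi_map).
End Verma.

Definition weight_space (V : lmodType K) (rho : lieModule g_A V)
    (lambda : {linear h -> K^o}) : set V :=
  [set w | forall (x : h') (y : h''),
     rho (hA_in (fmon x 0, y)) w = (lambda (val x + val y) : K) *: w].

Section TensorA.
Context {V : lmodType K} (rho : lieModule g_A V).
Local Notation VA := (laurent n V).

Definition loop_act (f : laurent n g') (u : VA) : VA :=
  conv +%R (fun m X w => rho (loop_in H2 (fmon X m)) w) f u.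
Definition hsec_VA (x : h'') (u : VA) : VA :=
  cmap (fun _ => rho (hsec_in n x)) u.

Definition VA_act (p : gAt n H2) (u : VA) : VA :=
  loop_act p.1.1 u + hsec_VA p.1.2 u + deg_der p.2 u.

Let loop_in_lin : linear (@loop_in K G n H2).
Proof. by move=> a f g; congr pair; rewrite /= scaler0 addr0. Qed.
Let hsec_in_lin : linear (@hsec_in K G n H2).
Proof. by move=> a x y; congr pair; rewrite /= scaler0 addr0. Qed.
Let b_linl (m : Zn n) (w : V) :
  linear (fun X : g' => rho (loop_in H2 (fmon X m)) w).
Proof. by move=> a X Y; rewrite fmon_lin loop_in_lin lact_linl. Qed.
Let b_linr (m : Zn n) (X : g') : linear (rho (loop_in H2 (fmon X m))).
Proof. exact: lact_linr. Qed.

Lemma loop_actU X m w s : loop_act (fmon X m) (fmon w s) =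
  fmon (rho (loop_in H2 (fmon X m)) w) (m + s).
Proof. by rewrite /loop_act convU. Qed.
Lemma loop_act_linl u : linear (loop_act^~ u).
Proof. exact: conv_linl. Qed.
Lemma loop_act_linr f : linear (loop_act f).
Proof. exact: conv_linr. Qed.

Lemma hsec_VAU x w s : hsec_VA x (fmon w s) = fmon (rho (hsec_in n x) w) s.
Proof. by rewrite /hsec_VA cmapU // => _; exact: lact_linr. Qed.
Lemma hsec_VA_linr x : linear (hsec_VA x).
Proof. by apply: cmap_lin => _; exact: lact_linr. Qed.
Lemma hsec_VA_linl u : linear (hsec_VA^~ u).
Proof.
move=> a x y; elim/fsum_ind: u => [|u v IHu IHv|z m].
- by rewrite !(lin0 (hsec_VA_linr _)) scaler0 addr0.
- rewrite (linD (hsec_VA_linr (_ + _))) (linD (hsec_VA_linr x)).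
  by rewrite (linD (hsec_VA_linr y)) scalerDr addrACA; exact: (congr2 +%R IHu IHv).
by rewrite !hsec_VAU hsec_in_lin lact_linl fmon_lin.
Qed.

Lemma VA_act_linl u : linear (VA_act^~ u).
Proof.
move=> a p q; rewrite /VA_act /= loop_act_linl hsec_VA_linl deg_der_linl.
by rewrite !scalerDr [LHS](AC (2*2*2) ((1*3*5)*(2*4*6))).
Qed.
Lemma VA_act_linr p : linear (VA_act p).
Proof.
move=> a u v; rewrite /VA_act loop_act_linr hsec_VA_linr deg_der_linr.
by rewrite !scalerDr [LHS](AC (2*2*2) ((1*3*5)*(2*4*6))).
Qed.

Let ext1 (F F' : VA -> VA) : linear F -> linear F' ->
  (forall w s, F (fmon w s) = F' (fmon w s)) -> F =1 F'.
Proof. exact: fsum_ext. Qed.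

Let lin_comp (F F' : VA -> VA) : linear F -> linear F' -> linear (F \o F').
Proof. by move=> l l' a u v; rewrite /= l' l. Qed.
Let lin_sub (F F' : VA -> VA) : linear F -> linear F' ->
  linear (fun u => F u - F' u).
Proof.
by move=> l l' a u v; rewrite l l' scalerBr opprD addrACA.
Qed.

Let loop_lie f g u :
  loop_act (lie f g) u = loop_act f (loop_act g u) - loop_act g (loop_act f u).
Proof.
elim/fsum_ind: f => [|f f' IH IH'|X m].
- rewrite (lin0 (lie_linl g)) !(lin0 (loop_act_linl _)).
  by rewrite (lin0 (loop_act_linr _)) subr0.
- rewrite (linD (lie_linl g)) !(linD (loop_act_linl _)) (linD (loop_act_linr _)).
  by rewrite opprD addrACA; exact: (congr2 +%R IH IH').
elim/fsum_ind: g => [|g g' IH IH'|Y s].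
- rewrite (lin0 (lie_linr _)) !(lin0 (loop_act_linl _)).
  by rewrite (lin0 (loop_act_linr _)) subr0.
- rewrite (linD (lie_linr _)) !(linD (loop_act_linl _)) (linD (loop_act_linr _)).
  by rewrite opprD addrACA; exact: (congr2 +%R IH IH').
move: u; apply: ext1.
- exact: loop_act_linr.
- by apply: lin_sub; apply: lin_comp; exact: loop_act_linr.
move=> w k; rewrite loopU !loop_actU (addrA m) (addrA s) (addrC s m).
rewrite -(linB (fmon_lin _)) -lact_lie; congr (fmon (rho _ w) _).
congr pair; rewrite /= !hsec_der0.
by rewrite subr0 addr0 loopU.
Qed.

Let hsec_loop x f u :
  loop_act (hsec_der x f) u = hsec_VA x (loop_act f u) - loop_act f (hsec_VA x u).
Proof.
elim/fsum_ind: f => [|f f' IH IH'|X m].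
- rewrite (lin0 (hsec_der_linr _)) !(lin0 (loop_act_linl _)).
  by rewrite (lin0 (hsec_VA_linr _)) subr0.
- rewrite (linD (hsec_der_linr _)) !(linD (loop_act_linl _)) (linD (hsec_VA_linr _)).
  by rewrite opprD addrACA; exact: (congr2 +%R IH IH').
move: u; apply: ext1.
- exact: loop_act_linr.
- by apply: lin_sub; apply: lin_comp;
    first [exact: loop_act_linr | exact: hsec_VA_linr].
move=> w k; rewrite hsec_derU !loop_actU !hsec_VAU loop_actU.
rewrite -(linB (fmon_lin _)) -lact_lie; congr (fmon (rho _ w) _).
congr pair; rewrite /= (lin0 (lie_linl _)) add0r.
by rewrite hsec_der0 subr0 hsec_derU.
Qed.

Let hsec_comm x y u : hsec_VA x (hsec_VA y u) = hsec_VA y (hsec_VA x u).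
Proof.
move: u; apply: ext1.
- by apply: lin_comp; exact: hsec_VA_linr.
- by apply: lin_comp; exact: hsec_VA_linr.
move=> w k; rewrite !hsec_VAU; congr fmon.
apply/eqP; rewrite -subr_eq0 -lact_lie.
have -> : lie (hsec_in n x) (hsec_in n y) = 0 :> g_A.
  congr pair; rewrite /= (lin0 (lie_linl _)) !(lin0 (hsec_der_linr _)).
  by rewrite addr0 subr0.
by rewrite (lin0 (lact_linl rho w)).
Qed.

Let deg_loop d f u :
  loop_act (deg_der d f) u = deg_der d (loop_act f u) - loop_act f (deg_der d u).
Proof.
elim/fsum_ind: f => [|f f' IH IH'|X m].
- rewrite (lin0 (deg_der_linr _)) !(lin0 (loop_act_linl _)).
  by rewrite (lin0 (deg_der_linr _)) subr0.
- rewrite (linD (deg_der_linr d) f) !(linD (loop_act_linl _)).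
  rewrite (linD (deg_der_linr d)).
  by rewrite opprD addrACA; exact: (congr2 +%R IH IH').
move: u; apply: ext1.
- exact: loop_act_linr.
- by apply: lin_sub; apply: lin_comp;
    first [exact: loop_act_linr | exact: deg_der_linr].
move=> w k; rewrite !deg_derU (linZ (loop_act_linl _)) (linZ (loop_act_linr _)).
by rewrite !loop_actU deg_derU ddotD -scalerBl addrK.
Qed.

Let deg_hsec_VA d x u : deg_der d (hsec_VA x u) = hsec_VA x (deg_der d u).
Proof.
move: u; apply: ext1.
- by apply: lin_comp; first [exact: deg_der_linr | exact: hsec_VA_linr].
- by apply: lin_comp; first [exact: deg_der_linr | exact: hsec_VA_linr].
by move=> w k; rewrite deg_derU !hsec_VAU deg_derU (linZ (hsec_VA_linr _)) hsec_VAU.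
Qed.

Let commutator_sum (F P X Y D E N : VA -> VA) :
  linear F -> linear P -> linear X -> linear Y -> linear D -> linear E ->
  (forall u, N u = (F (P u) - P (F u)) + (X (P u) - P (X u)) - (Y (F u) - F (Y u))
     + (D (P u) - P (D u)) - (E (F u) - F (E u))) ->
  (forall u, Y (X u) = X (Y u)) -> (forall u, E (D u) = D (E u)) ->
  (forall u, D (Y u) = Y (D u)) -> (forall u, E (X u) = X (E u)) ->
  forall u, N u = F (P u + Y u + E u) + X (P u + Y u + E u) + D (P u + Y u + E u)
    - (P (F u + X u + D u) + Y (F u + X u + D u) + E (F u + X u + D u)).
Proof.
move=> lF lP lX lY lD lE NE YX ED DY EX u; rewrite NE.
rewrite !(linD lF) !(linD lP) !(linD lX) !(linD lY) !(linD lD) !(linD lE).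
rewrite YX ED DY EX !opprB !opprD.
rewrite [RHS](AC ((3*3*3)*(3*3*3)) (((1*10)*(4*11)*(2*13)*(7*12)*(3*16))
  *((5*14)*(6*17)*(8*15)*(9*18)))) /=.
by rewrite !subrr !addr0.
Qed.

Let loop_act_bracket f g x y d e u :
  loop_act (lie f g + hsec_der x g - hsec_der y f + deg_der d g - deg_der e f) u =
  (loop_act f (loop_act g u) - loop_act g (loop_act f u))
  + (hsec_VA x (loop_act g u) - loop_act g (hsec_VA x u))
  - (hsec_VA y (loop_act f u) - loop_act f (hsec_VA y u))
  + (deg_der d (loop_act g u) - loop_act g (deg_der d u))
  - (deg_der e (loop_act f u) - loop_act f (deg_der e u)).
Proof.
have lD := linD (loop_act_linl u); have lB := linB (loop_act_linl u).
apply: etrans (lB _ _) (congr2 (fun a b => a - b) _ (deg_loop e f u)).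
apply: etrans (lD _ _) (congr2 +%R _ (deg_loop d g u)).
apply: etrans (lB _ _) (congr2 (fun a b => a - b) _ (hsec_loop y f u)).
exact: etrans (lD _ _) (congr2 +%R (loop_lie f g u) (hsec_loop x g u)).
Qed.

Lemma VA_act_lie p q u :
  VA_act (lie p q) u = VA_act p (VA_act q u) - VA_act q (VA_act p u).
Proof.
case: p q => [[f x] d] [[g y] e].
pose N u := loop_act
  (lie f g + hsec_der x g - hsec_der y f + deg_der d g - deg_der e f) u.
have NE : VA_act (lie (((f, x), d) : gAt n H2) (((g, y), e) : gAt n H2)) u = N u.
  rewrite /VA_act /= -[RHS]addr0 -[X in _ = X + _]addr0.
  congr (_ + _ + _); last exact: (lin0 (deg_der_linl u)).
  have -> : (0 + 0 - 0 : h'') = 0 by rewrite subr0 addr0.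
  exact: (lin0 (hsec_VA_linl u)).
apply: (etrans NE); apply: commutator_sum.
- exact: loop_act_linr.
- exact: loop_act_linr.
- exact: hsec_VA_linr.
- exact: hsec_VA_linr.
- exact: deg_der_linr.
- exact: deg_der_linr.
- by move=> {u NE} u; exact: loop_act_bracket.
- by move=> {u NE} u; exact: hsec_comm.
- by move=> {u NE} u; exact: deg_der_comm.
- by move=> {u NE} u; exact: deg_hsec_VA.
- by move=> {u NE} u; exact: deg_hsec_VA.
Qed.

Definition VA_module : lieModule (gAt n H2) VA :=
  LieModule VA_act_linl VA_act_linr VA_act_lie.
End TensorA.
End HighestWeight.
Arguments hA {K G} n H2.


Section Sigma.
Context {K : fieldType} {G : kacMoody K} {n : nat} {H2 : submodClosed (km_h G)}.
Context {V : lmodType K} (rho : lieModule (gA n H2) V).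

(* [z] stands for [xi_i]. *)
Definition is_sigma (v : V) (i : 'I_n) (z : K) (sigma : {linear V -> V}) : Prop :=
  [/\ bijective sigma,
      sigma v = v,
      forall (X : derivedAlg G) (m : Zn n) (w : V),
        sigma (rho (loop_in H2 (fmon X m)) w) =
        z ^ (m i) *: rho (loop_in H2 (fmon X m)) (sigma w)
    & forall (x : subm H2) (w : V),
        sigma (rho (hsec_in n x) w) = rho (hsec_in n x) (sigma w)].

Definition eta (i : 'I_n) (z : K) (sigma : {linear V -> V}) :
    laurent n V -> laurent n V :=
  cmap (fun (s : Zn n) w => z ^ (- s i) *: sigma w).

(* An element [k] of the product of the [Z/r_i Z] is given by residues in ['I_(r i)]. *)
Definition VA_grade (r : 'I_n -> nat) (xi : 'I_n -> K) (sigma : 'I_n -> {linear V -> V})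
    (k : forall i, 'I_(r i)) : set (laurent n V) :=
  [set u | forall i, eta i (xi i) (sigma i) u = xi i ^ (- (k i : nat)%:Z) *: u].
End Sigma.

(* C[t_1^{+-r_1}, ..., t_n^{+-r_n}]: the span of the [t^m] with [r_i | m_i]. *)
Definition laurent_powers (K : fieldType) (n : nat) (r : 'I_n -> nat) :
    set (laurentAlg n K) :=
  [set a | forall m : Zn n, a@_m != 0 -> forall i, ((r i)%:Z %| m i)%Z].
Arguments laurent_powers K {n} r.

(* Main.v *)
Require Import Defs.
From HB Require Import structures.
From mathcomp Require Import all_boot all_algebra.
From mathcomp Require Import boolp classical_sets reals complex.
From mathcomp Require Import finmap monalg.

Set Implicit Arguments.
Unset Strict Implicit.
Unset Printing Implicit Defensive.

Import GRing.Theory.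
Local Open Scope ring_scope.
Local Open Scope classical_set_scope.

(** Write [U] for the enveloping algebra of [g_A (+) D], and [V] for [V(psi)].
    The maps [eta_i] commute with [U] and multiply [v (x) t^m] by
    [xi_i^(-m_i)], so that [U (v (x) t^m)] lies in the component of degree [m].

    For the converse, say that a monomial of degree [p] is a vector obtained
    from [v] by applying elements [X (x) t^a] with the [a] adding up to [p], and
    elements of [h'']. Applying the same elements of [g_A] to [v (x) t^s]
    instead gives [w (x) t^(p + s)], where [w] is the monomial
    ([monomial_cyclic]).

    An element of [h' (x) A] acts on [v (x) b], [b] in [A], by multiplying [b]
    by the image of that element in [A_psi] ([psi_mon_act]). Hence the set of
    those [b] with [v (x) b] in a given submodule is an [A_psi]-module
    ([Apsi_cyclic]), and since [A_psi] contains [t^q] whenever every [r_i]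
    divides [q_i], the orbit of [v (x) t^m] contains all [v (x) t^(m + q)] with
    such [q]. It thus contains [w (x) t^s] for every monomial [w] whose degree
    is congruent to [s - m] modulo the [r_i].

    There remains to see that these suffice. If [u] is in the component of
    degree [m], its coefficient [u_s] satisfies
    [sigma_i u_s = xi_i^(s_i - m_i) u_s] for all [i]. Now [u_s] is a sum of
    monomials, as [v] generates [V], and a monomial of degree [p] is an
    eigenvector of [sigma_i] of eigenvalue [xi_i^(p_i)]. Averaging over the
    powers of each [sigma_i] kills the monomials of the other eigenvalues and
    fixes [u_s] ([joint_eigen_lspan]), so [u_s] is a sum of monomials of degree
    congruent to [s - m] ([eigen_cyclic]). *)

(** * Spans and cyclic modules *)

Lemma lspan_ind (K : fieldType) (V : lmodType K) (Q P : set V) :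
  P 0 -> (forall a x y, P x -> P y -> P (a *: x + y)) -> Q `<=` P ->
  forall x, x \in lspan Q -> P x.
Proof.
move=> P0 PD QP x; pose S : {pred V} := fun x => `[< P x >].
have S_closed : submod_closed S.
  split; first exact/asboolP.
  by move=> a y z /asboolP Py /asboolP Pz; apply/asboolP; exact: PD.
pose Sm : submodClosed V :=
  HB.pack S (GRing.isSubmodClosed.Build K V S S_closed).
move=> Qx; apply/asboolP; move: x Qx; apply: (@lspan_min _ _ _ Sm) => y Qy.
by apply/asboolP; exact: QP.
Qed.

Lemma lspan_le (K : fieldType) (V : lmodType K) (Q Q' : set V) :
  Q `<=` Q' -> {subset lspan Q <= lspan Q'}.
Proof. by move=> QQ'; apply: lspan_min => y /QQ'; exact: lspan_mem. Qed.

(** Every element of the enveloping algebra is a combination of words in the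
    generators, and a nonempty word is a generator times a shorter word. *)
Lemma envl_ind (K : fieldType) (L : lieAlgType K) (P : envl L -> Prop) :
  P 0 -> (forall a u u', P u -> P u' -> P (a *: u + u')) -> P 1 ->
  (forall x u, P u -> P (Defs.iota x * u)) -> forall u, P u.
Proof.
move=> P0 PD P1 PM u; rewrite -[u]envl_reprK.
elim/fsum_ind: (envl_repr u) => [|p q Pp Pq|c s].
- by rewrite (lin0 (@envl_pi_lin _ _)).
- by rewrite (linD (@envl_pi_lin _ _)) -[envl_pi p]scale1r; exact: PD.
have Pw : P (envl_pi (fmon (1 : K^o) s)).
  elim: s => [|x s IH]; first exact: P1.
  have -> : fmon (1 : K^o) (x :: s) = fgen x * fmon (1 : K^o) s :> freeAlg L.
    by rewrite -[RHS]/(free_mul _ _) free_mulU mulr1.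
  by rewrite envl_piM; exact: PM.
have -> : fmon (c : K^o) s = c *: fmon (1 : K^o) s :> freeAlg L.
  by rewrite -[RHS](linZ (fmon_lin _)) /GRing.scale /= mulr1.
by rewrite (linZ (@envl_pi_lin _ _)) -[_ *: _]addr0; exact: PD.
Qed.

(** The submodule [U(L) w]. *)
Definition cyclic (K : fieldType) (L : lieAlgType K) (W : lmodType K)
    (rho : lieModule L W) (w : W) : {pred W} :=
  fun y => `[< exists u, uact rho u w = y >].

Section Cyclic.
Context {K : fieldType} {L : lieAlgType K} {W : lmodType K}.
Context (rho : lieModule L W) (w : W).

Lemma cyclic_closed : submod_closed (cyclic rho w).
Proof.
split; first by apply/asboolP; exists 0; exact: (lin0 (uact_linl _ _)).
move=> a x y /asboolP[u <-] /asboolP[u' <-]; apply/asboolP.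
by exists (a *: u + u'); rewrite uact_linl.
Qed.
HB.instance Definition _ :=
  GRing.isSubmodClosed.Build K W (cyclic rho w) cyclic_closed.

Lemma cyclic_id : w \in cyclic rho w.
Proof. by apply/asboolP; exists 1; rewrite uact1. Qed.

Lemma cyclic_act x y : y \in cyclic rho w -> rho x y \in cyclic rho w.
Proof.
by move=> /asboolP[u <-]; apply/asboolP; exists (Defs.iota x * u);
  rewrite uactM uact_iota.
Qed.

Lemma uact_ind (P : set W) :
  P 0 -> (forall a x y, P x -> P y -> P (a *: x + y)) -> P w ->
  (forall x y, P y -> P (rho x y)) -> forall u, P (uact rho u w).
Proof.
move=> P0 PD Pw Pact; apply: envl_ind.
- by rewrite (lin0 (uact_linl rho w)).
- by move=> a u u' Pu Pu'; rewrite uact_linl; exact: PD.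
- by rewrite uact1.
- by move=> x u Pu; rewrite uactM uact_iota; exact: Pact.
Qed.
End Cyclic.

(** * Joint eigenvectors inside a span of eigenvectors *)

Lemma exprz_eq1_prim (K : fieldType) (r : nat) (z : K) (a : int) :
  r.-primitive_root z -> (z ^ a == 1) = (r%:Z %| a)%Z.
Proof.
move=> zr; rewrite dvdzE /= (prim_order_dvd zr).
case: a => a //=; last by rewrite NegzE -exprnN invr_eq1.
Qed.

Section EigenSpan.
Context {K : fieldType} {W : lmodType K}.

Definition average (sigma : W -> W) (r : nat) (mu : K) (w : W) : W :=
  \sum_(a < r) mu ^- a *: iter a sigma w.

(** For distinct [r]-th roots of unity [nu] and [mu], the quotient [nu / mu] is
    a root of unity other than [1], and its first [r] powers add up to [0]. *)
Lemma average_eigen (sigma : {linear W -> W}) r mu nu w :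
  mu ^+ r = 1 -> nu ^+ r = 1 -> sigma w = nu *: w ->
  average sigma r mu w = (if nu == mu then r%:R else 0) *: w.
Proof.
case: r => [|r]; first by rewrite /average big_ord0 if_same scale0r.
move=> mur nur sw.
have mu0 : mu != 0.
  by apply/eqP => mu0; move: mur; rewrite mu0 expr0n => /esym/eqP; rewrite oner_eq0.
have E a : iter a sigma w = nu ^+ a *: w.
  by elim: a => [|a IH]; rewrite ?scale1r //= IH linearZ /= sw scalerA exprSr.
have -> : average sigma r.+1 mu w = (\sum_(a < r.+1) (nu / mu) ^+ a) *: w.
  rewrite scaler_suml; apply: eq_bigr => a _.
  by rewrite E scalerA exprMn exprVn mulrC.
congr (_ *: _); case: eqVneq => [->|numu].
  rewrite divff // (eq_bigr (fun=> 1)) => [|a _]; last by rewrite expr1n.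
  by rewrite sumr_const card_ord.
have := subrX1 (nu / mu) r.+1.
rewrite exprMn exprVn nur mur invr1 mulr1 subrr => /esym/eqP.
rewrite mulf_eq0 subr_eq0 => /orP[/eqP E1|/eqP //].
by move/eqP: numu; case; rewrite -[nu](divfK mu0) E1 mul1r.
Qed.

Lemma average_lin (sigma : {linear W -> W}) r mu : linear (average sigma r mu).
Proof.
move=> c x y; rewrite /average scaler_sumr -big_split /=; apply: eq_bigr => a _.
have -> : iter a sigma (c *: x + y) = c *: iter a sigma x + iter a sigma y.
  by elim: (nat_of_ord a) => //= b ->; rewrite linearP.
by rewrite scalerDr !scalerA mulrC.
Qed.

(** Up to the factor [r], averaging fixes [w], while it keeps only the terms of
    eigenvalue [mu] in any expression of [w] as a combination of elements of
    [Q]. *)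
Lemma eigen_lspan (sigma : {linear W -> W}) r mu (Q : set W) w :
  r%:R != 0 :> K -> mu ^+ r = 1 ->
  (forall y, Q y -> exists2 nu, nu ^+ r = 1 & sigma y = nu *: y) ->
  w \in lspan Q -> sigma w = mu *: w ->
  w \in lspan (Q `&` [set y | sigma y = mu *: y]).
Proof.
move=> r0 mur Qeig Qw sw.
suff : average sigma r mu w \in lspan (Q `&` [set y | sigma y = mu *: y]).
  rewrite (average_eigen mur mur sw) eqxx => Aw.
  by rewrite -[w](scalerK r0) rpredZ.
move: w Qw {sw}; apply: lspan_ind.
- by rewrite (lin0 (average_lin _ _ _)) rpred0.
- by move=> a x y Ax Ay; rewrite average_lin rpredD ?rpredZ.
move=> y Qy; have [nu nur sy] := Qeig y Qy.
rewrite (average_eigen mur nur sy).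
case: eqVneq => [numu|_]; last by rewrite scale0r rpred0.
by rewrite rpredZ // lspan_mem //; split; rewrite //= sy numu.
Qed.

(** The selection of terms made for one operator leaves elements of [Q], so the
    operators can be treated one after the other. *)
Lemma joint_eigen_lspan (I : finType) (sigma : I -> {linear W -> W})
    (r : I -> nat) (mu : I -> K) (Q : set W) w :
  (forall i, (r i)%:R != 0 :> K) -> (forall i, mu i ^+ r i = 1) ->
  (forall y, Q y -> forall i, exists2 nu, nu ^+ r i = 1 & sigma i y = nu *: y) ->
  w \in lspan Q -> (forall i, sigma i w = mu i *: w) ->
  w \in lspan (Q `&` [set y | forall i, sigma i y = mu i *: y]).
Proof.
move=> r0 mur Qeig Qw sw.
suff H (l : seq I) : w \in lspan (Q `&` [set y | forall i, i \in l -> sigma i y = mu i *: y]).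
  move: (H (enum I)); apply: lspan_le => y [Qy sy]; split=> // i.
  by apply: sy; rewrite mem_enum.
elim: l => [|i l IH]; first by move: Qw; apply: lspan_le => y.
have := eigen_lspan (r0 i) (mur i) _ IH (sw i) => /(_ (fun y Qy => Qeig y Qy.1 i)).
apply: lspan_le => y [[Qy ly] iy]; split=> // j.
by rewrite inE => /orP[/eqP->|/ly].
Qed.
End EigenSpan.

(** * Monomials and the action on the loop module *)

Section LoopModule.
Context {K : fieldType} {G : kacMoody K} {n : nat} {H2 : submodClosed (km_h G)}.
Local Notation g_A := (gA n H2).
Context {V : lmodType K} (rho : lieModule g_A V).

(** The degree is an index of the relation, not a function of the vector: words
    of different degrees may well give the same vector. *)
Inductive monomial (v : V) : Zn n -> V -> Prop :=
| monomial1 : monomial v 0 v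
| monomial_loop X m p w : monomial v p w ->
    monomial v (m + p) (rho (loop_in H2 (fmon X m)) w)
| monomial_hsec x p w : monomial v p w -> monomial v p (rho (hsec_in n x) w).

Lemma gA_ind (P : g_A -> Prop) :
  (forall x y, P x -> P y -> P (x + y)) ->
  (forall X m, P (loop_in H2 (fmon X m))) -> (forall x, P (hsec_in n x)) ->
  forall x, P x.
Proof.
move=> PD PX Ph [f x].
have -> : (f, x) = loop_in H2 f + hsec_in n x :> g_A.
  by congr pair; rewrite /= ?addr0 ?add0r.
apply: (PD) => //; elim/fsum_ind: f => [||//]; first exact: (Ph 0).
move=> f g Pf Pg; have -> : loop_in H2 (f + g) = loop_in H2 f + loop_in H2 g.
  by congr pair; rewrite /= addr0.
exact: PD.
Qed.

Lemma uact_monomial v u :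
  uact rho u v \in lspan [set w | exists p, monomial v p w].
Proof.
apply: (uact_ind (P := [set w | w \in lspan _])).
- exact: rpred0.
- by move=> a x y ? ?; rewrite /= rpredD ?rpredZ.
- by apply: lspan_mem; exists 0; exact: monomial1.
move=> x; apply: lspan_ind => [||y [p py]].
- by rewrite /= (lin0 (lact_linr rho x)) rpred0.
- by move=> a y z ? ?; rewrite /= lact_linr rpredD ?rpredZ.
elim/gA_ind: x => [x x' Hx Hx'|X m|x].
- by rewrite /= (linD (lact_linl rho y)) rpredD.
- by apply: lspan_mem; exists (m + p); exact: monomial_loop.
- by apply: lspan_mem; exists p; exact: monomial_hsec.
Qed.

(** [sigma] commutes with [h''] and with each [X (x) t^m] up to [z^(m_i)];
    these factors accumulate along the word. *)
Lemma sigma_monomial v i z (sigma : {linear V -> V}) p w : z != 0 ->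
  is_sigma rho v i z sigma -> monomial v p w -> sigma w = z ^ (p i) *: w.
Proof.
move=> z0 [_ sv sX sh]; elim=> [|X m {}p {}w _ IH|x {}p {}w _ IH].
- by rewrite sv ffunE expr0z scale1r.
- by rewrite sX IH (linZ (lact_linr rho _)) scalerA ffunE expfzDr.
- by rewrite sh IH (linZ (lact_linr rho _)).
Qed.

Local Notation VA := (VA_module rho).

Lemma VA_act_loop X m w s :
  VA (loop_in H2 (fmon X m), 0) (fmon w s) =
  fmon (rho (loop_in H2 (fmon X m)) w) (m + s).
Proof.
rewrite /= /VA_act /= loop_actU (lin0 (hsec_VA_linl _ _)) (lin0 (deg_der_linl _)).
by rewrite !addr0.
Qed.

Lemma VA_act_hsec x w s :
  VA (hsec_in n x, 0) (fmon w s) = fmon (rho (hsec_in n x) w) s.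
Proof.
rewrite /= /VA_act /= (lin0 (loop_act_linl _ _)) hsec_VAU (lin0 (deg_der_linl _)).
by rewrite add0r addr0.
Qed.

Lemma gAt_ind (P : gAt n H2 -> Prop) :
  (forall x y, P x -> P y -> P (x + y)) ->
  (forall X m, P (loop_in H2 (fmon X m), 0)) ->
  (forall x, P (hsec_in n x, 0)) -> (forall d, P (0, d)) -> forall x, P x.
Proof.
move=> PD PX Ph Pd [x d].
have -> : (x, d) = (x, 0) + (0, d) :> gAt n H2.
  by congr pair; rewrite /= ?addr0 ?add0r.
apply: (PD) => //; elim/gA_ind: x => [x y Px Py|//|//].
have -> : (x + y, 0) = (x, 0) + (y, 0) :> gAt n H2 by congr pair; rewrite /= addr0.
exact: PD.
Qed.

(** Replaying on [v (x) t^s] the word that makes [w] from [v] shifts the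
    exponent of [t] by the degree of the word. *)
Lemma monomial_cyclic v p w x s : monomial v p w ->
  fmon v s \in cyclic VA x -> fmon w (p + s) \in cyclic VA x.
Proof.
move=> mw vs; elim: mw => [|X m {}p {}w _ IH|y {}p {}w _ IH].
- by rewrite add0r.
- by rewrite -addrA -VA_act_loop cyclic_act.
- by rewrite -VA_act_hsec cyclic_act.
Qed.

Section Eta.
Context (v : V) (i : 'I_n) (z : K) (sigma : {linear V -> V}).
Hypothesis z0 : z != 0.
Hypothesis sigmaP : is_sigma rho v i z sigma.

Let eta_in_lin (s : Zn n) : linear (fun w => z ^ (- s i) *: sigma w).
Proof. by move=> a x y; rewrite linearP scalerDr !scalerA mulrC. Qed.

Lemma eta_lin : linear (@Defs.eta K n V i z sigma).
Proof. exact: cmap_lin. Qed.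

Lemma etaU w s : Defs.eta i z sigma (fmon w s) = z ^ (- s i) *: fmon (sigma w) s.
Proof. by rewrite /Defs.eta cmapU // (linZ (fmon_lin _)). Qed.

Lemma etaE u s : (Defs.eta i z sigma u)@_s = z ^ (- s i) *: sigma u@_s.
Proof. exact: cmapE. Qed.

(** The factor [z^(m_i)] that [sigma] picks up when crossing [X (x) t^m] is
    compensated by the factor [z^(-m_i)] due to the change of exponent of [t]. *)
Lemma eta_act x u : Defs.eta i z sigma (VA x u) = VA x (Defs.eta i z sigma u).
Proof.
have [_ _ sX sh] := sigmaP.
elim/fsum_ind: u => [|u u' IH IH'|w s].
- by rewrite (lin0 (lact_linr VA _)) (lin0 eta_lin) (lin0 (lact_linr VA _)).
- have D := linD (lact_linr VA x).
  have E := congr1 (VA x) (linD eta_lin u u').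
  apply: etrans (congr1 (Defs.eta i z sigma) (D u u')) _.
  apply: etrans (linD eta_lin _ _) _.
  apply: etrans (congr2 +%R IH IH') _.
  exact: esym (etrans E (D _ _)).
rewrite etaU (linZ (lact_linr VA x)).
move: x; apply: gAt_ind => [x x' IH IH'|X m|x|d].
- have D w' := linD (lact_linl VA (fmon w' s)) x x'.
  apply: etrans (congr1 (Defs.eta i z sigma) (D w)) _.
  apply: etrans (linD eta_lin _ _) _.
  apply: etrans (congr2 +%R IH IH') _.
  apply: esym; apply: etrans (scalerDr _ _ _); exact: congr1 (D (sigma w)).
- rewrite !VA_act_loop etaU sX (linZ (fmon_lin _)) scalerA ffunE.
  by rewrite opprD expfzDr // mulrAC -expfzDr // addNr expr0z mul1r.
- by rewrite !VA_act_hsec etaU sh.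
- have E w' : VA (0, d) (fmon w' s) = ddot d s *: fmon w' s.
    rewrite /= /VA_act /= (lin0 (loop_act_linl _ _)) (lin0 (hsec_VA_linl _ _)).
    by rewrite !add0r deg_derU.
  by rewrite !E (linZ eta_lin) etaU !scalerA mulrC.
Qed.
End Eta.
End LoopModule.

(** * The orbit of a highest weight vector *)

Section HighestWeightOrbit.
Context {K : fieldType} {G : kacMoody K} {n : nat} {H2 : submodClosed (km_h G)}.
Context (psi : {linear hA n H2 -> K^o}) (V : irrQuotient psi).
Context (v : V) (hv : highest_weight_vector v).
Local Notation rho := (irr_act V).
Local Notation VA := (VA_module rho).

Lemma irr_pi_uact u :
  irr_pi V (verma_pi psi u) = uact rho u (irr_pi V (verma_vec psi)).
Proof.
elim/envl_ind: u => [|a u u' IH IH'||x u IH].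
- rewrite (lin0 (uact_linl _ _)) (lin0 (@verma_pi_lin _ _ _ _ _)).
  by rewrite (lin0 (@irr_pi_lin _ _ _ _ _ _)).
- by rewrite verma_pi_lin irr_pi_lin IH IH' uact_linl.
- by rewrite uact1.
by rewrite uactM uact_iota -IH -irr_pi_act /= verma_actE.
Qed.

Lemma hwv_generates w : exists u, uact rho u v = w.
Proof.
have [c c0 ->] := hv; have [q <-] := irr_pi_surj w.
exists (c^-1 *: lrepr _ q).
rewrite (linZ (uact_linl _ _)) (linZ (uact_linr _ _)) scalerA mulVf // scale1r.
by rewrite -irr_pi_uact /verma_pi lreprK.
Qed.

Lemma hwv_weight y : rho (hA_in y) v = (psi y : K) *: v.
Proof.
have [c c0 ->] := hv; rewrite (linZ (lact_linr rho _)) scalerA mulrC -scalerA.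
congr (_ *: _); rewrite -irr_pi_act /= verma_actE mulr1.
rewrite -(linZ (@irr_pi_lin _ _ _ _ _ _)) -(linZ (@verma_pi_lin _ _ _ _ _)).
congr (irr_pi _ _); apply/lpiP; apply: lspan_mem; right.
by exists 1, y; rewrite mul1r.
Qed.

(** [a |-> v (x) a]. *)
Definition hwv_tensor (a : laurentAlg n K) : laurent n V :=
  cmap (fun _ (c : K^o) => c *: v) a.

Let scale_v_lin (m : Zn n) : linear (fun c : K^o => c *: v).
Proof. by move=> a c d; rewrite scalerDl scalerA. Qed.

Lemma hwv_tensor_lin : linear hwv_tensor.
Proof. exact: cmap_lin. Qed.

Lemma hwv_tensorU c m : hwv_tensor (fmon c m) = fmon (c *: v) m.
Proof. exact: cmapU. Qed.

Lemma hprime_in_lin : linear (@hprime_in K G).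
Proof. by move=> a x y; apply: val_inj; rewrite /= km_in_lin. Qed.

(** Since [h (x) t^m] acts on [v] by the scalar [psi (h (x) t^m)], it sends
    [v (x) b] to [v (x) (psi (h (x) t^m) t^m b)], and the element multiplying
    [b] is the generator of [A_psi] given by [h (x) t^m]. *)
Lemma psi_mon_act y b :
  VA (loop_in H2 (cmap (fun _ => @hprime_in K G) y), 0) (hwv_tensor b) =
  hwv_tensor (psi_mon psi y * b).
Proof.
have act f u : VA (loop_in H2 f, 0) u = loop_act rho f u.
  by rewrite /= /VA_act /= (lin0 (hsec_VA_linl _ _)) (lin0 (deg_der_linl _)) !addr0.
have cl : linear (cmap (fun _ : Zn n => @hprime_in K G)).
  by apply: cmap_lin => _; exact: hprime_in_lin.
rewrite act; elim/fsum_ind: y => [|y y' IH IH'|x m].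
- rewrite (lin0 cl) (lin0 (psi_mon_lin psi)) mul0r (lin0 hwv_tensor_lin).
  exact: (lin0 (loop_act_linl _ _)).
- rewrite (linD cl) (linD (psi_mon_lin psi)) mulrDl (linD hwv_tensor_lin).
  by rewrite (linD (loop_act_linl _ _)) IH IH'.
rewrite psi_monU cmapU; last by move=> _; exact: hprime_in_lin.
elim/fsum_ind: b => [|b b' IH IH'|c s].
- by rewrite mulr0 (lin0 hwv_tensor_lin) (lin0 (loop_act_linr _ _)).
- by rewrite mulrDr !(linD hwv_tensor_lin) (linD (loop_act_linr _ _)) IH IH'.
rewrite -[_ * _ in RHS]/(laurent_mul _ _) laurent_mulU !hwv_tensorU loop_actU.
congr fmon; rewrite (linZ (lact_linr rho _)) mulrC -scalerA; congr (_ *: _).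
rewrite -hwv_weight; congr (rho _ _); congr pair.
by rewrite /= cmapU // => _; exact: hprime_in_lin.
Qed.

(** A submodule is stable under the generators of [A_psi], by [psi_mon_act],
    hence under all products and combinations of them. *)
Lemma Apsi_cyclic x a b : Apsi psi a ->
  hwv_tensor b \in cyclic VA x -> hwv_tensor (a * b) \in cyclic VA x.
Proof.
move=> [u _ <-] bx; elim/envl_ind: u => [|c u u' IH IH'||y u IH].
- by rewrite linear0 mul0r (lin0 hwv_tensor_lin) rpred0.
- have -> : envl_lift (psi_map psi) (c *: u + u') * b =
      c *: (envl_lift (psi_map psi) u * b) + envl_lift (psi_map psi) u' * b.
    apply: etrans (congr1 (laurent_mul^~ b) (envl_lift_lin _ c u u')) _.
    exact: laurent_mul_linl.
  have := (cyclic_closed VA x).2 c _ _ IH IH'.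
  by rewrite -hwv_tensor_lin.
- by rewrite rmorph1 mul1r.
by rewrite rmorphM /= envl_lift_iota -mulrA -psi_mon_act cyclic_act.
Qed.

Lemma Apsi_shift x m q : Apsi psi (fmon (1 : K^o) q) ->
  fmon v m \in cyclic VA x -> fmon v (q + m) \in cyclic VA x.
Proof.
move=> /Apsi_cyclic H vm; have := H x (fmon (1 : K^o) m).
rewrite -[_ * _]/(laurent_mul _ _) laurent_mulU !hwv_tensorU.
by rewrite mulr1 scale1r; exact.
Qed.

Context (r : 'I_n -> nat) (xi : 'I_n -> K).
Hypothesis xiP : forall i, (r i).-primitive_root (xi i).
Hypothesis Apsi_r : Apsi psi = laurent_powers K r.
Context (sigma : 'I_n -> {linear V -> V}).
Hypothesis sigmaP : forall i, is_sigma rho v i (xi i) (sigma i).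

Let xi0 i : xi i != 0.
Proof. by rewrite (prim_root_eq0 (xiP i)) -lt0n (prim_order_gt0 (xiP i)). Qed.

(** By averaging, [w] may be taken to be a monomial, of degree [p] say. If
    [w != 0], then [xi_i^(p_i) = xi_i^(s_i - m_i)], that is, each [r_i] divides
    the coordinate [q_i] of [q = s - p - m]. The orbit then contains
    [v (x) t^(q + m)], and the word of [w] sends it to [w (x) t^s]. *)
Lemma eigen_cyclic (m s : Zn n) w :
  (forall i, sigma i w = xi i ^ (s i - m i) *: w) ->
  fmon w s \in cyclic VA (fmon v m).
Proof.
move=> sw.
have xir i (a : int) : (xi i ^ a) ^+ r i = 1.
  by rewrite exprnP exprz_exp mulrC -exprz_exp -exprnP (prim_expr_order (xiP i)) exp1rz.
have [u uw] := hwv_generates w.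
have Mw : w \in lspan [set w | exists p, monomial rho v p w].
  by rewrite -uw; exact: uact_monomial.
have : w \in lspan ([set w | exists p, monomial rho v p w] `&`
    [set y | forall i, sigma i y = xi i ^ (s i - m i) *: y]).
  apply: (joint_eigen_lspan (r := r)) => // [i|y [p py] i].
  - exact: prim_root_natf_neq0 (xiP i).
  - exists (xi i ^ p i) => //; exact: sigma_monomial (xi0 i) (sigmaP i) py.
move: w {sw uw Mw}; apply: lspan_ind.
- by rewrite (lin0 (fmon_lin _)) rpred0.
- by move=> a x y Px Py; rewrite /= fmon_lin rpredD ?rpredZ.
move=> w [[p pw] sw]; have [->|w0] := eqVneq w 0.
  by rewrite (lin0 (fmon_lin _)) rpred0.
pose q := s - p - m.
have -> : s = p + (q + m) by rewrite /q subrK addrC subrK.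
apply: monomial_cyclic (pw) _; apply: Apsi_shift; last exact: cyclic_id.
rewrite Apsi_r => j; rewrite lcoefU.
case: (q =P j) => [<- _ i|]; last by rewrite mulr0n eqxx.
rewrite -(exprz_eq1_prim _ (xiP i)) /q !ffunE addrAC expfzDr // -exprz_inv.
have := sigma_monomial (xi0 i) (sigmaP i) pw; rewrite (sw i) => /eqP.
rewrite -subr_eq0 -scalerBl scaler_eq0 (negPf w0) orbF subr_eq0 => /eqP ->.
by rewrite exprz_inv -expfzDr // subrr.
Qed.

Lemma exprz_eq_mod i (a b : int) :
  (a = b %[mod (r i)%:Z])%Z -> xi i ^ a = xi i ^ b.
Proof.
move=> /eqP; rewrite eqz_mod_dvd -(exprz_eq1_prim _ (xiP i)) => /eqP E.
by rewrite -[a](subrK b) expfzDr // E mul1r.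
Qed.

Lemma cyclic_grade (k : forall i, 'I_(r i)) (m : Zn n) :
  (forall i, (m i = (k i : nat)%:Z %[mod (r i)%:Z])%Z) ->
  [set uact VA u (fmon v m) | u in [set: envl (gAt n H2)]] = VA_grade xi sigma k.
Proof.
move=> mk; apply/seteqP; split=> y.
  move=> [u _ <-]; apply: uact_ind => [i|a x x' Px Px' i|i|x x' Px' i].
  - by rewrite (lin0 (eta_lin _ _ _)) scaler0.
  - by rewrite (eta_lin _ _ _ a x x') Px Px' scalerDr !scalerA mulrC.
  - have [_ sv _ _] := sigmaP i.
    by rewrite etaU sv -!invr_expz (exprz_eq_mod (mk i)).
  - by rewrite (eta_act (xi0 i) (sigmaP i)) Px' (linZ (lact_linr VA x)).
move=> yk; suff : y \in cyclic VA (fmon v m) by move=> /asboolP[u uy]; exists u.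
rewrite [y]monalgE rpred_sum // => s _; apply: eigen_cyclic => i.
have := congr1 (fun u : laurent n V => u@_s) (yk i).
rewrite /= etaE lcoefZ -!invr_expz -(exprz_eq_mod (mk i)) => E.
rewrite expfzDr // -[xi i ^ (- m i)]invr_expz -scalerA -E scalerA.
by rewrite divff ?expfz_neq0 // scale1r.
Qed.
End HighestWeightOrbit.

Theorem theorem4p2 (R : realType) (G : kacMoody R[i])
    (H2 : submodClosed (km_h G)) (hH2 : is_complement H2)
    (n : nat) (r : 'I_n -> nat) (xi : 'I_n -> R[i])
    (hxi : forall i, (r i).-primitive_root (xi i))
    (psi : {linear hA n H2 -> R[i]^o}) (V : irrQuotient psi)
    (hfin : forall lambda : {linear km_h G -> R[i]^o},
       finite_dim (weight_space (irr_act V) lambda))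
    (hApsi : Apsi psi = laurent_powers R[i] r)
    (hR : (2 <= \prod_(i < n) r i)%N)
    (v : V) (hv : highest_weight_vector v)
    (sigma : 'I_n -> {linear V -> V})
    (hsigma : forall i, is_sigma (irr_act V) v i (xi i) (sigma i))
    (k : forall i : 'I_n, 'I_(r i)) (m : Zn n)
    (hm : forall i, (m i = (k i : nat)%:Z %[mod (r i)%:Z])%Z) :
  [set uact (VA_module (irr_act V)) u (fmon v m) | u in [set: envl (gAt n H2)]]
  = VA_grade xi sigma k.
Proof.
exact: (cyclic_grade hv hxi hApsi hsigma hm).
Qed.
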